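(* Let $\mu^B\colon\mathbb B\to\mathbb A$ and $\mu^C\colon\mathbb C\to\mathbb A$ be morphisms of graphs of groups, and let $\mathbb D=\mathbb B\,\widetilde\times_{\mathbb A}\,\mathbb C$ be their $\mathbb A$-product, with projections $\rho^B,\rho^C$. (1) Let $v\in V(\mathsf B)$ and $w\in V(\mathsf C)$ be such that $\mu^B(v)=\mu^C(w)$, and let $x\in V_{v,w}$ be a vertex of $\mathsf D$ over $(v,w)$. Then $$\bigl((\mu^B\circ\rho^B)_*(\pi_1(\mathbb D,x))\bigr)^{\tilde x}=(\mu^C\circ\rho^C)_*(\pi_1(\mathbb D,x))\le\bigl(\mu^B_*(\pi_1(\mathbb B,v))\bigr)^{\tilde x}\cap\mu^C_*(\pi_1(\mathbb C,w)),$$ with equality if $\mu^B$ and $\mu^C$ are immersions. (2) Let $u_0\in V(\mathsf A)$, $v_0\in V(\mathsf B)$, $w_0\in V(\mathsf C)$ with $\mu^B(v_0)=\mu^C(w_0)=u_0$, and let $(\mathbb D,x_0)$ be the $\mathbb A$-product of $\mu^B$ and $\mu^C$ seen as morphisms of pointed graphs of groups (so $x_0=\mu^B(B_{v_0})\mu^C(C_{w_0})$ and $\tilde x_0=1$). Then $$(\mu^B\circ\rho^B)_*(\pi_1(\mathbb D,x_0))=(\mu^C\circ\rho^C)_*(\pi_1(\mathbb D,x_0))\le\mu^B_*(\pi_1(\mathbb B,v_0))\cap\mu^C_*(\pi_1(\mathbb C,w_0)),$$ with equality if $\mu^B$ and $\mu^C$ are immersions. (3) Let $v,w,x$ be as in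 (1) and $v_0,w_0$ as in (2), let $p_v$ be a reduced $\mathbb B$-path from $v_0$ to $v$ and let $q_w$ be a reduced $\mathbb C$-path from $w_0$ to $w$. Then $$\bigl(\mu^C_*\circ\rho^C_*(\pi_1(\mathbb D,x))\bigr)^{\mu^C(q_w)^{-1}}\le\mu^B_*(\pi_1(\mathbb B,v_0))^{\mu^B(p_v)\,\tilde x\,\mu^C(q_w)^{-1}}\cap\mu^C_*(\pi_1(\mathbb C,w_0)),$$ with equality if $\mu^B$ and $\mu^C$ are immersions.
   Context: **Conventions.** For group (or groupoid) elements, $x^g=g^{-1}xg$, $H^g=g^{-1}Hg$ and $\gamma_g(x)=x^g$. A graph $\mathsf A$ has a vertex set $V(\mathsf A)$, an edge set $E(\mathsf A)$, maps $o,t\colon E(\mathsf A)\to V(\mathsf A)$ and a fixed-point-free involution $e\mapsto e^{-1}$ on edges with $t(e^{-1})=o(e)$; graph morphisms preserve this structure. **Graphs of groups.** A graph of groups $\mathbb A$ consists of a graph $\mathsf A$, vertex groups $A_u$, edge groups $A_e=A_{e^{-1}}$, and monomorphisms $\alpha_e\colon A_e\to A_{o(e)}$, $\omega_e\colon A_e\to A_{t(e)}$ with $\omega_e=\alpha_{e^{-1}}$. **Paths.** An $\mathbb A$-path of length $k$ is a sequence $p=(a_0,e_1,a_1,\dots,e_k,a_k)$ where $(e_1,\dots,e_k)$ is a path in $\mathsf A$, $a_{i-1}\in A_{o(e_i)}$, $a_k\in A_{t(e_k)}$ (for $k=0$: $p=(a)$ with $a$ in a vertex group). Paths are concatenated by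 multiplying the adjacent group elements; $p^{-1}=(a_k^{-1},e_k^{-1},\dots,e_1^{-1},a_0^{-1})$; a circuit is a path with equal ends. The congruence $=_{\mathbb A}$ is generated by $(1,e,\omega_e(x),e^{-1},1)=_{\mathbb A}(\alpha_e(x))$, $x\in A_e$. The quotient of the category of $\mathbb A$-paths by $=_{\mathbb A}$ is the fundamental groupoid $\pi_1(\mathbb A)$; $\pi_1(\mathbb A,u)$ is the group of classes of circuits at $u$. A path is reduced if $a_i\notin\omega_{e_i}(A_{e_i})$ whenever $e_{i+1}=e_i^{-1}$. **Morphisms.** A morphism $\mu\colon\mathbb B\to\mathbb A$ consists of a graph morphism $\mathsf B\to\mathsf A$ (also written $\mu$), monomorphisms $\mu_v\colon B_v\to A_{\mu(v)}$ and $\mu_f\colon B_f\to A_{\mu(f)}$, and, for each edge $f$ of $\mathsf B$, twisting elements $f_\alpha\in A_{\mu(o(f))}$, $f_\omega\in A_{\mu(t(f))}$ with $(f^{-1})_\alpha=f_\omega$ and $(f^{-1})_\omega=f_\alpha$, such that with $e=\mu(f)$, $v=o(f)$, $v'=t(f)$: $\alpha_e\circ\mu_f=\gamma_{f_\alpha}\circ\mu_v\circ\alpha_f$ and $\omega_e\circ\mu_f=\gamma_{f_\omega}\circ\mu_{v'}\circ\omega_f$. (We often omit subscripts on $\mu$.) It acts on paths by $\mu(b_0,f_1,b_1,\dots,f_k,b_k)=(\mu(b_0)(f_1)_\alpha,\mu(f_1),(f_1)_\omega^{-1}\mu(b_1)(f_2)_\alpha,\dots,\mu(f_k),(f_k)_\omega^{-1}\mu(b_k))$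 and induces a groupoid morphism $\mu_*\colon\pi_1(\mathbb B)\to\pi_1(\mathbb A)$ and group morphisms $\mu_*\colon\pi_1(\mathbb B,v)\to\pi_1(\mathbb A,\mu(v))$. Composition is the obvious one. **Immersions.** $\mu$ is an immersion if (i) for edges $f,f'$ of $\mathsf B$ with common origin $v$ and common image $e$, $f=f'$ if and only if $\mu_v(B_v)f_\alpha\alpha_e(A_e)=\mu_v(B_v)f'_\alpha\alpha_e(A_e)$; and (ii) for every edge $f$ with $v=o(f)$, $e=\mu(f)$: $\alpha_e(\mu_f(B_f))=\mu_v(B_v)^{f_\alpha}\cap\alpha_e(A_e)$. **The $\mathbb A$-product.** Given $\mu^B\colon\mathbb B\to\mathbb A$, $\mu^C\colon\mathbb C\to\mathbb A$, the $\mathbb A$-product $\mathbb D=\mathbb B\,\widetilde\times_{\mathbb A}\,\mathbb C$ is defined as follows. For vertices $v,w$ with $\mu^B(v)=\mu^C(w)=u$ let $V_{v,w}$ be the set of double cosets $\mu^B(B_v)\,a\,\mu^C(C_w)$, $a\in A_u$; for edges $f,g$ with $\mu^B(f)=\mu^C(g)=e$ let $E_{f,g}$ be the set of double cosets $\mu^B(B_f)\,a\,\mu^C(C_g)$, $a\in A_e$. Then $V(\mathsf D)=\bigsqcup V_{v,w}$, $E(\mathsf D)=\bigsqcup E_{f,g}$; the inverse of $h\in E_{f,g}$ is the same double coset viewed in $E_{f^{-1},g^{-1}}$; and the edge $\mu^B(B_f)\,a\,\mu^C(C_g)$ has origin $\mu^B(B_{o(f)})\,(f_\alpha\alpha_e(a)g_\alpha^{-1})\,\mu^C(C_{o(g)})$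 and terminus $\mu^B(B_{t(f)})\,(f_\omega\omega_e(a)g_\omega^{-1})\,\mu^C(C_{t(g)})$. Fix representatives $\tilde x\in x$ and $\tilde h=\widetilde{h^{-1}}\in h$ of the double cosets, and for each $h\in E_{f,g}$ with $o(h)=x\in V_{v,w}$ fix $b_h\in B_v$, $c_h\in C_w$ with $\tilde x=\mu^B(b_h)f_\alpha\alpha_e(\tilde h)g_\alpha^{-1}\mu^C(c_h)^{-1}$. Put $D_x=\{(b,c)\in B_v\times C_w:\tilde x^{-1}\mu^B(b)\tilde x=\mu^C(c)\}$, $D_h=\{(b,c)\in B_f\times C_g:\tilde h^{-1}\mu^B(b)\tilde h=\mu^C(c)\}$, $\alpha_h(b,c)=(b_h\alpha_f(b)b_h^{-1},\,c_h\alpha_g(c)c_h^{-1})$, $\omega_h=\alpha_{h^{-1}}$. The projections $\rho^B\colon\mathbb D\to\mathbb B$, $\rho^C\colon\mathbb D\to\mathbb C$ send $x\in V_{v,w}$ to $v$, $w$ and $h\in E_{f,g}$ to $f$, $g$, are the coordinate projections on vertex and edge groups, and have $\alpha$-twisting elements $b_h$, $c_h$. In the pointed case the basepoint is $x_0=\mu^B(B_{v_0})\mu^C(C_{w_0})\in V_{v_0,w_0}$, with $\tilde x_0=1$. *)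

(* Defs.v *)
From Stdlib Require Eqdep.
From HB Require Import structures.
From mathcomp Require Import all_boot.
From mathcomp Require Import generic_quotient boolp classical_sets.

Set Implicit Arguments.
Unset Strict Implicit.
Unset Printing Implicit Defensive.

Local Open Scope classical_set_scope.
Local Open Scope quotient_scope.
Local Open Scope group_scope.

Notation "{ 'ghom' G -> H }" :=
  (UMagmaMorphism.type G H) (at level 0, G at level 98, H at level 99).

Section FiberProd.
Variables (G H K : groupType) (m : {ghom G -> K}) (n : {ghom H -> K}) (k : K).

Definition fiberprod_pred : pred (G * H) :=
  fun z => k^-1 * m z.1 * k == n z.2.

Record fiberprod := FiberProd {fpval :> G * H; fpvalP : fiberprod_pred fpval}.

HB.instance Definition _ := [isSub for fpval].
HB.instance Definition _ := [Choice of fiberprod by <:].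

Fact fiberprod_closed : group_closed fiberprod_pred.
Proof.
split; first by rewrite unfold_in /fiberprod_pred !gmulf1 mulg1 mulVg.
move=> x y; rewrite !unfold_in /fiberprod_pred => /eqP hx /eqP hy.
by rewrite !gmulfF /= -hx -hy !invgM !invgK !mulgA mulgK.
Qed.

HB.instance Definition _ :=
  SubChoice_isSubGroup.Build (G * H)%type fiberprod_pred fiberprod
    fiberprod_closed.

End FiberProd.

Section Cast.
Variables (I : Type) (F : I -> groupType).

Definition gcast i j (p : i = j) : F i -> F j :=
  match p in _ = j return F i -> F j with erefl => id end.

Fact gcastF i j (p : i = j) : {morph gcast p : x y / x / y}.
Proof. by case: _ / p. Qed.

HB.instance Definition _ i j (p : i = j) :=
  isGroupMorphism.Build (F i) (F j) (gcast p) (gcastF p).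

Lemma gcast_inj i j (p : i = j) : injective (gcast p).
Proof. by case: j / p => x y. Qed.

Lemma gcast_id i (p : i = i) x : gcast p x = x.
Proof. by rewrite (Prop_irrelevance p erefl). Qed.

Lemma gcast_trans i j k (p : i = j) (q : j = k) (r : i = k) x :
  gcast q (gcast p x) = gcast r x.
Proof. by move: q r; case: _ / p => q r; rewrite (Prop_irrelevance q r). Qed.

End Cast.

Arguments gcast {I} F {i j} p x.

Section DoubleCosets.
Variable G : groupType.

Definition dcoset (H : set G) (a : G) (K : set G) : set G :=
  [set x | exists2 h, H h & exists2 k, K k & x = h * a * k].

Record double_coset (H K : set G) := DoubleCoset {
  dc_set : set G;
  dc_setP : exists a, dc_set = dcoset H a K }.

End DoubleCosets.

(* A graph is given by its vertices and, for all vertices u and v, the type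
   [hedge u v] of the edges with origin u and terminus v. *)
Record graph := Graph {
  vert :> Type;
  hedge : vert -> vert -> Type;
  einv : forall u v, hedge u v -> hedge v u;
  einvK : forall u v (e : hedge u v), einv (einv e) = e;
  einv_neq : forall u (e : hedge u u), einv e <> e }.
Arguments hedge {g} u v.
Arguments einv {g u v} e.

(* The set of all edges of a graph: edges between a priori distinct pairs of
   vertices are compared here. *)
Record edge (X : graph) := Edge { esrc : X; etgt : X; earr : hedge esrc etgt }.
Arguments Edge {X esrc etgt} earr.

(* The equality of the edge groups of e and e^-1 is rendered by an
   identification [ebar], subject to omega_e = alpha_{e^-1} and
   alpha_e = omega_{e^-1}. It is automatically an involutive group isomorphism:
   see [ebarF] and [ebarK]. *)
Record graph_of_groups := GraphOfGroups {
  gog_graph :> graph;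
  gV : gog_graph -> groupType;
  gE : forall u v : gog_graph, hedge u v -> groupType;
  galpha : forall (u v : gog_graph) (e : hedge u v), {ghom gE e -> gV u};
  gomega : forall (u v : gog_graph) (e : hedge u v), {ghom gE e -> gV v};
  galpha_inj : forall (u v : gog_graph) (e : hedge u v), injective (galpha e);
  gomega_inj : forall (u v : gog_graph) (e : hedge u v), injective (gomega e);
  ebar : forall (u v : gog_graph) (e : hedge u v), gE e -> gE (einv e);
  gomegaE : forall (u v : gog_graph) (e : hedge u v) (x : gE e),
    gomega e x = galpha (einv e) (ebar x);
  galphaE : forall (u v : gog_graph) (e : hedge u v) (x : gE e),
    galpha e x = gomega (einv e) (ebar x) }.
Arguments gV {g} u.
Arguments gE {g u v} e.
Arguments galpha {g u v} e.
Arguments gomega {g u v} e.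
Arguments ebar {g u v e} x.

Definition gEt (A : graph_of_groups) (d : edge A) : groupType := gE (earr d).

Section GraphOfGroupsTheory.
Variable A : graph_of_groups.

Definition gEcast (u v u' v' : A) (e : hedge u v) (e' : hedge u' v')
    (q : Edge e = Edge e') : gE e -> gE e' := gcast (@gEt A) q.

Fact gEcastF (u v u' v' : A) (e : hedge u v) (e' : hedge u' v')
  (q : Edge e = Edge e') : {morph gEcast q : x y / x / y}.
Proof. by move=> x y; exact: (@gcastF _ (@gEt A) _ _ q x y). Qed.

HB.instance Definition _ (u v u' v' : A) (e : hedge u v) (e' : hedge u' v')
    (q : Edge e = Edge e') :=
  isGroupMorphism.Build (gE e) (gE e') (gEcast q) (gEcastF q).

Lemma gEcast_inj (u v u' v' : A) (e : hedge u v) (e' : hedge u' v')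
  (q : Edge e = Edge e') : injective (gEcast q).
Proof. exact: (@gcast_inj _ (@gEt A) _ _ q). Qed.

Lemma gEcast_trans (u v u' v' u'' v'' : A) (e : hedge u v) (e' : hedge u' v')
    (e'' : hedge u'' v'') (q : Edge e = Edge e') (q' : Edge e' = Edge e'')
    (r : Edge e = Edge e'') x :
  gEcast q' (gEcast q x) = gEcast r x.
Proof. exact: (@gcast_trans _ (@gEt A) _ _ _ q q' r x). Qed.

Lemma gEcast_galpha (u v u' v' : A) (e : hedge u v) (e' : hedge u' v')
    (q : Edge e = Edge e') (p : u = u') (x : gE e) :
  gcast gV p (galpha e x) = galpha e' (gEcast q x).
Proof.
have gen (d d' : edge A) (r : d = d') (s : esrc d = esrc d') (y : gEt d) :
    gcast gV s (galpha (earr d) y) = galpha (earr d') (gcast (@gEt A) r y).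
  by case: d' / r s => s; rewrite gcast_id.
exact: (gen _ _ q p x).
Qed.

Lemma einv_Edge (u v u' v' : A) (e : hedge u v) (e' : hedge u' v') :
  Edge e = Edge e' -> Edge (einv e) = Edge (einv e').
Proof. exact: (congr1 (fun d : edge A => Edge (einv (earr d)))). Qed.

Lemma gEcast_ebar (u v u' v' : A) (e : hedge u v) (e' : hedge u' v')
    (q : Edge e = Edge e') (r : Edge (einv e) = Edge (einv e')) (x : gE e) :
  gEcast r (ebar x) = ebar (gEcast q x).
Proof.
have gen (d d' : edge A) (s : d = d')
    (t : Edge (einv (earr d)) = Edge (einv (earr d'))) (y : gEt d) :
    gcast (@gEt A) t (ebar y) = ebar (gcast (@gEt A) s y).
  by case: d' / s t => t; rewrite gcast_id.
exact: (gen _ _ q r x).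
Qed.

Lemma ebarF (u v : A) (e : hedge u v) : {morph @ebar A u v e : x y / x / y}.
Proof.
move=> x y; apply: (@galpha_inj A).
by rewrite gmulfF -!gomegaE gmulfF.
Qed.

Lemma gEcast_gomega (u v u' v' : A) (e : hedge u v) (e' : hedge u' v')
    (q : Edge e = Edge e') (p : v = v') (x : gE e) :
  gcast gV p (gomega e x) = gomega e' (gEcast q x).
Proof.
have gen (d d' : edge A) (r : d = d') (s : etgt d = etgt d') (y : gEt d) :
    gcast gV s (gomega (earr d) y) = gomega (earr d') (gcast (@gEt A) r y).
  by case: d' / r s => s; rewrite gcast_id.
exact: (gen _ _ q p x).
Qed.

HB.instance Definition _ (u v : A) (e : hedge u v) :=
  isGroupMorphism.Build (gE e) (gE (einv e)) ebar (@ebarF u v e).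

Lemma ebarK (u v : A) (e : hedge u v) (q : Edge (einv (einv e)) = Edge e) x :
  gEcast q (ebar (ebar x)) = x.
Proof.
apply: (@galpha_inj A); rewrite -(gEcast_galpha q erefl) /=.
by rewrite -gomegaE -galphaE.
Qed.

End GraphOfGroupsTheory.

Record morphism (B A : graph_of_groups) := Morphism {
  mV :> B -> A;
  mE : forall u v : B, hedge u v -> hedge (mV u) (mV v);
  mE_inv : forall (u v : B) (f : hedge u v), mE (einv f) = einv (mE f);
  mVg : forall v : B, {ghom gV v -> gV (mV v)};
  mEg : forall (u v : B) (f : hedge u v), {ghom gE f -> gE (mE f)};
  mVg_inj : forall v : B, injective (mVg v);
  mEg_inj : forall (u v : B) (f : hedge u v), injective (mEg f);
  twa : forall u v : B, hedge u v -> gV (mV u);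
  two : forall u v : B, hedge u v -> gV (mV v);
  twa_inv : forall (u v : B) (f : hedge u v), twa (einv f) = two f;
  two_inv : forall (u v : B) (f : hedge u v), two (einv f) = twa f;
  malphaE : forall (u v : B) (f : hedge u v) (x : gE f),
    galpha (mE f) (mEg f x) = mVg u (galpha f x) ^ twa f;
  momegaE : forall (u v : B) (f : hedge u v) (x : gE f),
    gomega (mE f) (mEg f x) = mVg v (gomega f x) ^ two f }.

Arguments mE {B A} m {u v} f.
Arguments mVg {B A} m v.
Arguments mEg {B A} m {u v} f.
Arguments twa {B A} m {u v} f.
Arguments two {B A} m {u v} f.

(* An element of the edge group at mu(f), viewed in the edge group at
   mu(f^-1) = mu(f)^-1. *)
Definition mbar (B A : graph_of_groups) (mu : morphism B A) (u v : B)
    (f : hedge u v) (a : gE (mE mu f)) : gE (mE mu (einv f)) :=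
  gEcast (congr1 Edge (esym (mE_inv mu f))) (ebar a).
Arguments mbar {B A} mu {u v} f a.

Section MorphismTheory.
Variables (B A : graph_of_groups) (mu : morphism B A).

Lemma mbarE (u v : B) (f : hedge u v) (x : gE f) :
  mEg mu (einv f) (ebar x) = mbar mu f (mEg mu f x).
Proof.
apply: (@galpha_inj A); rewrite malphaE /mbar.
rewrite -(gEcast_galpha _ erefl) /= -!gomegaE momegaE.
by rewrite twa_inv.
Qed.

Lemma galpha_mbar (u v : B) (f : hedge u v) (a : gE (mE mu f)) :
  galpha (mE mu (einv f)) (mbar mu f a) = gomega (mE mu f) a.
Proof. by rewrite /mbar -(gEcast_galpha _ erefl) /= -gomegaE. Qed.

Lemma gomega_mbar (u v : B) (f : hedge u v) (a : gE (mE mu f)) :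
  gomega (mE mu (einv f)) (mbar mu f a) = galpha (mE mu f) a.
Proof. by rewrite /mbar -(gEcast_gomega _ erefl) /= -galphaE. Qed.

Lemma mbarK (u v : B) (f : hedge u v)
    (q : Edge (mE mu (einv (einv f))) = Edge (mE mu f)) (a : gE (mE mu f)) :
  gEcast q (mbar mu (einv f) (mbar mu f a)) = a.
Proof.
apply: (@galpha_inj A).
by rewrite -(gEcast_galpha q erefl) /= galpha_mbar gomega_mbar.
Qed.

Fact mbarF (u v : B) (f : hedge u v) : {morph mbar mu f : x y / x / y}.
Proof. by move=> x y; rewrite /mbar !gmulfF. Qed.

HB.instance Definition _ (u v : B) (f : hedge u v) :=
  isGroupMorphism.Build (gE (mE mu f)) (gE (mE mu (einv f)))
    (mbar mu f) (@mbarF u v f).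

Definition immersion : Prop :=
  (forall (v v1 v2 : B) (f : hedge v v1) (f' : hedge v v2),
     Edge (mE mu f) = Edge (mE mu f') ->
     (Edge f = Edge f' <->
      dcoset (range (mVg mu v)) (twa mu f) (range (galpha (mE mu f))) =
      dcoset (range (mVg mu v)) (twa mu f') (range (galpha (mE mu f))))) /\
  (forall (v v' : B) (f : hedge v v'),
     galpha (mE mu f) @` range (mEg mu f) =
     [set b ^ twa mu f | b in range (mVg mu v)]
       `&` range (galpha (mE mu f))).

End MorphismTheory.

Section Composition.
Variables (C B A : graph_of_groups) (mu : morphism B A) (nu : morphism C B).

Let cV (v : C) : A := mu (nu v).
Let cE (u v : C) (f : hedge u v) : hedge (cV u) (cV v) := mE mu (mE nu f).
Let cVg (v : C) : {ghom gV v -> gV (cV v)} := mVg mu (nu v) \o mVg nu v.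
Let cEg (u v : C) (f : hedge u v) : {ghom gE f -> gE (cE f)} :=
  mEg mu (mE nu f) \o mEg nu f.
Let ctwa (u v : C) (f : hedge u v) : gV (cV u) :=
  mVg mu (nu u) (twa nu f) * twa mu (mE nu f).
Let ctwo (u v : C) (f : hedge u v) : gV (cV v) :=
  mVg mu (nu v) (two nu f) * two mu (mE nu f).

Fact comp_mE_inv (u v : C) (f : hedge u v) : cE (einv f) = einv (cE f).
Proof. by rewrite /cE !mE_inv. Qed.
Fact comp_mVg_inj (v : C) : injective (cVg v).
Proof. by move=> x y /= /mVg_inj /mVg_inj. Qed.
Fact comp_mEg_inj (u v : C) (f : hedge u v) : injective (cEg f).
Proof. by move=> x y /= /mEg_inj /mEg_inj. Qed.
Fact comp_twa_inv (u v : C) (f : hedge u v) : ctwa (einv f) = ctwo f.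
Proof. by rewrite /ctwa /ctwo mE_inv !twa_inv. Qed.
Fact comp_two_inv (u v : C) (f : hedge u v) : ctwo (einv f) = ctwa f.
Proof. by rewrite /ctwa /ctwo mE_inv !two_inv. Qed.
Fact comp_malphaE (u v : C) (f : hedge u v) (x : gE f) :
  galpha (cE f) (cEg f x) = cVg u (galpha f x) ^ ctwa f.
Proof. by rewrite /= malphaE malphaE gmulfJ conjgM. Qed.
Fact comp_momegaE (u v : C) (f : hedge u v) (x : gE f) :
  gomega (cE f) (cEg f x) = cVg v (gomega f x) ^ ctwo f.
Proof. by rewrite /= momegaE momegaE gmulfJ conjgM. Qed.

Definition comp_morphism : morphism C A :=
  Morphism comp_mE_inv comp_mVg_inj comp_mEg_inj comp_twa_inv comp_two_inv
    comp_malphaE comp_momegaE.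

End Composition.


Section Paths.
Variable A : graph_of_groups.

(* [pcons a0 e1 p] is the path (a0, e1, a1, ..., ek, ak), where p is the path
   (a1, e2, ..., ek, ak) from t(e1). *)
Inductive gpath : A -> A -> Type :=
| pnil (u : A) (a : gV u) : gpath u u
| pcons (u v w : A) (a : gV u) (e : hedge u v) (p : gpath v w) : gpath u w.

Definition lmul (u v : A) (p : gpath u v) : gV u -> gpath u v :=
  match p in gpath u v return gV u -> gpath u v with
  | pnil u a => fun b => pnil (b * a)
  | pcons u v w a e p => fun b => pcons (b * a) e p
  end.

Fixpoint pcat (u v w : A) (p : gpath u v) : gpath v w -> gpath u w :=
  match p in gpath u v return gpath v w -> gpath u w with
  | pnil u a => fun q => lmul q a
  | pcons u v _ a e p => fun q => pcons a e (pcat p q)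
  end.

Fixpoint pinv (u v : A) (p : gpath u v) : gpath v u :=
  match p in gpath u v return gpath v u with
  | pnil u a => pnil a^-1
  | pcons u v w a e p => pcat (pinv p) (pcons 1 (einv e) (pnil a^-1))
  end.

(* The condition on the first vertex group element of p in the path
   consisting of e followed by p. *)
Definition reduced_after (u v w : A) (e : hedge u v) (p : gpath v w) : Prop :=
  match p in gpath v w return forall u, hedge u v -> Prop with
  | pnil v a => fun u e => True
  | pcons v v' w a e' p => fun u e =>
      Edge e' = Edge (einv e) -> ~ range (gomega e) a
  end u e.

Fixpoint reduced (u v : A) (p : gpath u v) : Prop :=
  match p with
  | pnil _ _ => True
  | pcons _ _ _ _ e p => reduced_after e p /\ reduced p
  end.

Inductive peq : forall u v : A, gpath u v -> gpath u v -> Prop :=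
| peq_refl (u v : A) (p : gpath u v) : peq p p
| peq_sym (u v : A) (p q : gpath u v) : peq p q -> peq q p
| peq_trans (u v : A) (p q r : gpath u v) : peq p q -> peq q r -> peq p r
| peq_cat (u v w : A) (p p' : gpath u v) (q q' : gpath v w) :
    peq p p' -> peq q q' -> peq (pcat p q) (pcat p' q')
| peq_edge (u v : A) (e : hedge u v) (x : gE e) :
    peq (pcons 1 e (pcons (gomega e x) (einv e) (pnil 1)))
        (pnil (galpha e x)).

HB.instance Definition _ (u v : A) := gen_eqMixin (gpath u v).
HB.instance Definition _ (u v : A) := gen_choiceMixin (gpath u v).

Definition peqb (u v : A) : rel (gpath u v) := fun p q => `[< peq p q >].

Fact peqb_refl (u v : A) : reflexive (@peqb u v).
Proof. by move=> p; apply/asboolP/peq_refl. Qed.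
Fact peqb_sym (u v : A) : symmetric (@peqb u v).
Proof. by move=> p q; apply/asboolP/asboolP; apply: peq_sym. Qed.
Fact peqb_trans (u v : A) : transitive (@peqb u v).
Proof.
move=> q p r /asboolP pq /asboolP qr; apply/asboolP; exact: peq_trans pq qr.
Qed.

Canonical peq_equiv (u v : A) :=
  EquivRel (@peqb u v) (@peqb_refl u v) (@peqb_sym u v) (@peqb_trans u v).

End Paths.

Arguments pnil {A u} a.
Arguments pcons {A u v w} a e p.

(* [phom u v] is the set of the morphisms from u to v of the fundamental
   groupoid, and [pi1 u] is the fundamental group at u. *)
Definition phom (A : graph_of_groups) (u v : A) := {eq_quot (@peqb A u v)}.
HB.instance Definition _ (A : graph_of_groups) (u v : A) :=
  Choice.on (phom u v).
HB.instance Definition _ (A : graph_of_groups) (u v : A) :=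
  EqQuotient.on (phom u v).
Definition pi1 (A : graph_of_groups) (u : A) := phom u u.
HB.instance Definition _ (A : graph_of_groups) (u : A) := Choice.on (pi1 u).

Section Groupoid.
Variable A : graph_of_groups.

Definition pclass (u v : A) (p : gpath u v) : phom u v :=
  \pi_(phom u v)%qT p.

Lemma pclassP (u v : A) (p q : gpath u v) : pclass p = pclass q <-> peq p q.
Proof.
split; first by move/eqmodP => /asboolP.
by move=> pq; apply/eqmodP/asboolP.
Qed.

Lemma repr_pclass (u v : A) (p : gpath u v) : peq (repr (pclass p)) p.
Proof. by apply/pclassP; rewrite /pclass reprK. Qed.

Definition pmul (u v w : A) (x : phom u v) (y : phom v w) : phom u w :=
  pclass (pcat (repr x) (repr y)).
Definition pone (u : A) : phom u u := pclass (pnil 1).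
Definition pV (u v : A) (x : phom u v) : phom v u := pclass (pinv (repr x)).

Lemma lmul1 (u v : A) (p : gpath u v) : lmul p 1 = p.
Proof. by case: p => [w a|w v' w' a e p] /=; rewrite mul1g. Qed.

Lemma lmulM (u v : A) (p : gpath u v) a b : lmul p (a * b) = lmul (lmul p b) a.
Proof. by case: p a b => [w a|w v' w' a e p] b c /=; rewrite mulgA. Qed.

Lemma pcat_lmul (u v w : A) (p : gpath u v) (q : gpath v w) a :
  pcat (lmul p a) q = lmul (pcat p q) a.
Proof. by case: p q a => [x b|x v' w' b e p] q a //=; rewrite lmulM. Qed.

Lemma pcatA (u v w x : A) (p : gpath u v) (q : gpath v w) (r : gpath w x) :
  pcat p (pcat q r) = pcat (pcat p q) r.
Proof.
elim: p q => [y a|y v' w' a e p IH] q /=; first by rewrite pcat_lmul.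
by rewrite IH.
Qed.

Lemma pcat1 (u v : A) (p : gpath u v) : pcat p (pnil 1) = p.
Proof. by elim: p => [x a|x v' w a e p /= ->] //=; rewrite mulg1. Qed.

Lemma lmulE (u v : A) (p : gpath u v) a : lmul p a = pcat (pnil a) p.
Proof. by []. Qed.

Lemma pinv_cat (u v w : A) (p : gpath u v) (q : gpath v w) :
  pinv (pcat p q) = pcat (pinv q) (pinv p).
Proof.
elim: p q => [x a|x v' w' a e p IH] q /=; last by rewrite IH pcatA.
case: q a => [y b|y v' w' b e q] a /=; first by rewrite invgM.
by rewrite -pcatA /= invgM.
Qed.

Lemma peq_pcons (u v w : A) a (e : hedge u v) (p q : gpath v w) :
  peq p q -> peq (pcons a e p) (pcons a e q).
Proof.
move=> pq; have := peq_cat (peq_refl (pcons a e (pnil 1))) pq.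
by rewrite /= !lmul1.
Qed.

Lemma peq_pcatV (u v : A) (p : gpath u v) : peq (pcat p (pinv p)) (pnil 1).
Proof.
elim: p => [x a|x v' w a e p IH] /=; first by rewrite mulgV; apply: peq_refl.
rewrite pcatA.
have h1 : peq (pcat (pcat p (pinv p)) (pcons 1 (einv e) (pnil a^-1)))
              (pcons 1 (einv e) (pnil a^-1)).
  by have := peq_cat IH (peq_refl (pcons 1 (einv e) (pnil a^-1)));
     rewrite /= mulg1.
apply: peq_trans (peq_pcons _ _ h1) _.
have h2 := peq_cat (peq_cat (peq_refl (pnil a)) (peq_edge (1 : gE e)))
  (peq_refl (pnil a^-1)).
by move: h2; rewrite /= !gmulf1 !mulg1 mul1g mulgV.
Qed.

Lemma pinvK (u v : A) (p : gpath u v) : pinv (pinv p) = p.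
Proof.
elim: p => [x a|x v' w a e p IH] /=; first by rewrite invgK.
by rewrite pinv_cat /= IH invgK einvK mulg1 invg1 lmul1.
Qed.

Lemma peq_pcatVl (u v : A) (p : gpath u v) : peq (pcat (pinv p) p) (pnil 1).
Proof. by have := peq_pcatV (pinv p); rewrite pinvK. Qed.

Lemma peq_inv (u v : A) (p q : gpath u v) : peq p q -> peq (pinv p) (pinv q).
Proof.
elim=> {u v p q} [u v p|u v p q _ h|u v p q r _ h _ h'
  |u v w p p' q q' _ h _ h'|u v e x].
- exact: peq_refl.
- exact: peq_sym.
- exact: peq_trans h h'.
- by rewrite !pinv_cat; apply: peq_cat.
- rewrite /= !invg1 !mulg1 einvK -!gmulfV. exact: peq_edge.
Qed.

Lemma pmul_class (u v w : A) (p : gpath u v) (q : gpath v w) :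
  pmul (pclass p) (pclass q) = pclass (pcat p q).
Proof. by apply/pclassP/peq_cat; apply: repr_pclass. Qed.

Lemma pV_class (u v : A) (p : gpath u v) : pV (pclass p) = pclass (pinv p).
Proof. by apply/pclassP/peq_inv/repr_pclass. Qed.

Lemma pclass_surj (u v : A) (x : phom u v) : exists p, x = pclass p.
Proof. by exists (repr x); rewrite /pclass reprK. Qed.

Lemma pmulA (u v w z : A) (x : phom u v) (y : phom v w) (t : phom w z) :
  pmul x (pmul y t) = pmul (pmul x y) t.
Proof.
have [p ->] := pclass_surj x; have [q ->] := pclass_surj y.
by have [r ->] := pclass_surj t; rewrite !pmul_class pcatA.
Qed.

Lemma pmul1 (u v : A) (x : phom u v) : pmul (pone u) x = x.
Proof. by have [p ->] := pclass_surj x; rewrite pmul_class /= lmul1. Qed.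

Lemma pmulr1 (u v : A) (x : phom u v) : pmul x (pone v) = x.
Proof. by have [p ->] := pclass_surj x; rewrite pmul_class pcat1. Qed.

Lemma pmulV (u v : A) (x : phom u v) : pmul (pV x) x = pone v.
Proof.
have [p ->] := pclass_surj x; rewrite pV_class pmul_class.
exact/pclassP/peq_pcatVl.
Qed.

Lemma pmulrV (u v : A) (x : phom u v) : pmul x (pV x) = pone u.
Proof.
have [p ->] := pclass_surj x; rewrite pV_class pmul_class.
exact/pclassP/peq_pcatV.
Qed.

HB.instance Definition _ (u : A) :=
  isGroup.Build (pi1 u) (@pmulA u u u u) (@pmul1 u u) (@pmulr1 u u)
    (@pmulV u u) (@pmulrV u u).

(* H^g, for g from u to v in the groupoid. *)
Definition pconj (u v : A) (H : set (pi1 u)) (g : phom u v) : set (pi1 v) :=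
  [set pmul (pmul (pV g) h) g | h in H].

(* When u = v, an element a of the vertex group at v is viewed as the path (a)
   of length 0 from u to v. *)
Definition vpath (u v : A) (p : u = v) (a : gV v) : gpath u v :=
  match esym p in _ = w return gpath w v with erefl => pnil a end.

Definition pi1_cast (u v : A) (p : u = v) (H : set (pi1 u)) : set (pi1 v) :=
  match p in _ = w return set (pi1 w) with erefl => H end.

End Groupoid.

Section InducedMaps.
Variables (B A : graph_of_groups) (mu : morphism B A).

Fixpoint gpmap (u v : B) (p : gpath u v) : gpath (mu u) (mu v) :=
  match p in gpath u v return gpath (mu u) (mu v) with
  | pnil u b => pnil (mVg mu u b)
  | pcons u v w b f p =>
      pcons (mVg mu u b * twa mu f) (mE mu f) (lmul (gpmap p) (two mu f)^-1)
  end.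

Definition mstar (u v : B) (x : phom u v) : phom (mu u) (mu v) :=
  pclass (gpmap (repr x)).

Definition pi1_image (v : B) : set (pi1 (mu v)) :=
  range (fun x : pi1 v => mstar x : pi1 (mu v)).

Lemma gpmap_lmul (u v : B) (p : gpath u v) b :
  gpmap (lmul p b) = lmul (gpmap p) (mVg mu u b).
Proof. by case: p b => [w a|w v' w' a e p] b /=; rewrite gmulfM ?mulgA. Qed.

Lemma gpmap_cat (u v w : B) (p : gpath u v) (q : gpath v w) :
  gpmap (pcat p q) = pcat (gpmap p) (gpmap q).
Proof.
elim: p q => [x a|x v' w' a e p IH] q /=; first exact: gpmap_lmul.
by rewrite IH pcat_lmul.
Qed.

Lemma peq_gpmap (u v : B) (p q : gpath u v) :
  peq p q -> peq (gpmap p) (gpmap q).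
Proof.
elim=> {u v p q} [u v p|u v p q _ h|u v p q r _ h _ h'
  |u v w p p' q q' _ h _ h'|u v f x].
- exact: peq_refl.
- exact: peq_sym.
- exact: peq_trans h h'.
- by rewrite !gpmap_cat; apply: peq_cat.
rewrite /= mE_inv twa_inv two_inv !gmulf1 !mulg1 !mul1g -conjgE -momegaE.
have := peq_cat (peq_cat (peq_refl (pnil (twa mu f))) (peq_edge (mEg mu f x)))
  (peq_refl (pnil (twa mu f)^-1)).
by rewrite /= !mulg1 mul1g malphaE conjgE !mulgA mulgV mul1g mulgK.
Qed.

Lemma mstar_class (u v : B) (p : gpath u v) :
  mstar (pclass p) = pclass (gpmap p).
Proof. exact/pclassP/peq_gpmap/repr_pclass. Qed.

Lemma mstarM (u v w : B) (x : phom u v) (y : phom v w) :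
  mstar (pmul x y) = pmul (mstar x) (mstar y).
Proof.
have [p ->] := pclass_surj x; have [q ->] := pclass_surj y.
by rewrite pmul_class !mstar_class pmul_class gpmap_cat.
Qed.

End InducedMaps.
Arguments gpmap {B A} mu {u v} p.
Arguments mstar {B A} mu {u v} x.
Arguments pi1_image {B A} mu v.

Section Product.
Variables (B C A : graph_of_groups).
Variables (muB : morphism B A) (muC : morphism C A).

(* For muB(v) = muC(w), the group A_u is gV (muC w), and the image of B_v is
   transported there; likewise for the edge groups. *)
Definition vmapB (v : B) (w : C) (p : muB v = muC w) :
  {ghom gV v -> gV (muC w)} := gcast gV p \o mVg muB v.

Definition emapB (v v' : B) (w w' : C) (f : hedge v v') (g : hedge w w')
    (q : Edge (mE muB f) = Edge (mE muC g)) : {ghom gE f -> gE (mE muC g)} :=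
  gEcast q \o mEg muB f.

Definition vdc (v : B) (w : C) (p : muB v = muC w) : Type :=
  double_coset (range (vmapB p)) (range (mVg muC w)).

Definition edc (v v' : B) (w w' : C) (f : hedge v v') (g : hedge w w')
    (q : Edge (mE muB f) = Edge (mE muC g)) : Type :=
  double_coset (range (emapB q)) (range (mEg muC g)).

(* The vertices of the product. *)
Record pvert := PVert {
  pvB : B;
  pvC : C;
  pv_base : muB pvB = muC pvC;
  pv_dc : vdc pv_base }.

Definition org_elt (v v' : B) (w w' : C) (p : muB v = muC w)
    (f : hedge v v') (g : hedge w w') (a : gE (mE muC g)) : gV (muC w) :=
  gcast gV p (twa muB f) * galpha (mE muC g) a * (twa muC g)^-1.

Definition ter_elt (v v' : B) (w w' : C) (p : muB v' = muC w')
    (f : hedge v v') (g : hedge w w') (a : gE (mE muC g)) : gV (muC w') :=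
  gcast gV p (two muB f) * gomega (mE muC g) a * (two muC g)^-1.

(* The edges of the product with origin x and terminus y. *)
Record pedge (x y : pvert) := PEdge {
  peB : hedge (pvB x) (pvB y);
  peC : hedge (pvC x) (pvC y);
  pe_base : Edge (mE muB peB) = Edge (mE muC peC);
  pe_dc : edc pe_base;
  pe_org : forall a, dc_set pe_dc a -> dc_set (pv_dc x) =
    dcoset (range (vmapB (pv_base x))) (org_elt (pv_base x) peB a)
      (range (mVg muC (pvC x)));
  pe_ter : forall a, dc_set pe_dc a -> dc_set (pv_dc y) =
    dcoset (range (vmapB (pv_base y))) (ter_elt (pv_base y) peB a)
      (range (mVg muC (pvC y))) }.

Lemma vmapB_inj (v : B) (w : C) (p : muB v = muC w) : injective (vmapB p).
Proof. by move=> x y xy; apply/(@mVg_inj _ _ muB)/(@gcast_inj _ _ _ _ p). Qed.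

Lemma emapB_inj (v v' : B) (w w' : C) (f : hedge v v') (g : hedge w w')
  (q : Edge (mE muB f) = Edge (mE muC g)) : injective (emapB q).
Proof. by move=> x y xy; apply/(@mEg_inj _ _ muB)/(@gEcast_inj _ _ _ _ _ _ _ q). Qed.

Lemma gcast_galphaB (v v' : B) (w w' : C) (p : muB v = muC w)
    (f : hedge v v') (g : hedge w w')
    (q : Edge (mE muB f) = Edge (mE muC g)) (b : gE f) :
  galpha (mE muC g) (emapB q b) =
  vmapB p (galpha f b) ^ gcast gV p (twa muB f).
Proof. by rewrite /= -(gEcast_galpha q p) malphaE gmulfJ. Qed.

Fact inv_base (v v' : B) (w w' : C) (f : hedge v v') (g : hedge w w') :
  Edge (mE muB f) = Edge (mE muC g) ->
  Edge (mE muB (einv f)) = Edge (mE muC (einv g)).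
Proof. by rewrite !mE_inv => /einv_Edge. Qed.

Lemma emapB_inv (v v' : B) (w w' : C) (f : hedge v v') (g : hedge w w')
    (q : Edge (mE muB f) = Edge (mE muC g)) (b : gE f) :
  emapB (inv_base q) (ebar b) = mbar muC g (emapB q b).
Proof.
rewrite /= mbarE /mbar -(gEcast_ebar q (einv_Edge q)).
set r1 := congr1 _ _; set r2 := congr1 _ _.
by rewrite (gEcast_trans _ _ (etrans r1 (inv_base q)))
  (gEcast_trans _ _ (etrans r1 (inv_base q))).
Qed.

Lemma org_elt_mbar (v v' : B) (w w' : C) (p : muB v' = muC w')
    (f : hedge v v') (g : hedge w w') (a : gE (mE muC g)) :
  org_elt p (einv f) (mbar muC g a) = ter_elt p f a.
Proof. by rewrite /org_elt /ter_elt !twa_inv galpha_mbar. Qed.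

Lemma ter_elt_mbar (v v' : B) (w w' : C) (p : muB v = muC w)
    (f : hedge v v') (g : hedge w w') (a : gE (mE muC g)) :
  ter_elt p (einv f) (mbar muC g a) = org_elt p f a.
Proof. by rewrite /org_elt /ter_elt !two_inv gomega_mbar. Qed.

Fact edc_inv_subproof (v v' : B) (w w' : C) (f : hedge v v') (g : hedge w w')
    (q : Edge (mE muB f) = Edge (mE muC g)) (D : edc q) :
  exists a, mbar muC g @` dc_set D =
    dcoset (range (emapB (inv_base q))) a (range (mEg muC (einv g))).
Proof.
case: D => D /= [a ->]; exists (mbar muC g a).
have surj (X : graph_of_groups) (u' u : X) (e : hedge u' u) (z : gE (einv e)) :
    exists y, z = ebar y.
  exists (gEcast (congr1 Edge (einvK e)) (ebar z)).
  apply: (@galpha_inj X); rewrite -gomegaE.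
  by rewrite -(gEcast_gomega _ erefl) /= galphaE.
apply/seteqP; split => z.
  case=> _ [_ [b _ <-] [_ [c _ <-] ->]] <-.
  exists (emapB (inv_base q) (ebar b)); first by exists (ebar b).
  exists (mEg muC (einv g) (ebar c)); first by exists (ebar c).
  by rewrite emapB_inv mbarE !gmulfM.
case=> _ [b _ <-] [_ [c _ <-] ->].
have [b' ->] := surj _ _ _ _ b; have [c' ->] := surj _ _ _ _ c.
exists (emapB q b' * a * mEg muC g c').
  by exists (emapB q b'); [exists b'|exists (mEg muC g c'); [exists c'|]].
by have /= -> := emapB_inv q b'; rewrite !gmulfM mbarE.
Qed.

Definition edc_inv (v v' : B) (w w' : C) (f : hedge v v') (g : hedge w w')
    (q : Edge (mE muB f) = Edge (mE muC g)) (D : edc q) : edc (inv_base q) :=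
  DoubleCoset (edc_inv_subproof D).

Fact pedge_inv_org (x y : pvert) (h : pedge x y) a :
  dc_set (edc_inv (pe_dc h)) a -> dc_set (pv_dc y) =
    dcoset (range (vmapB (pv_base y))) (org_elt (pv_base y) (einv (peB h)) a)
      (range (mVg muC (pvC y))).
Proof. by case=> b hb <-; rewrite org_elt_mbar; apply: pe_ter. Qed.

Fact pedge_inv_ter (x y : pvert) (h : pedge x y) a :
  dc_set (edc_inv (pe_dc h)) a -> dc_set (pv_dc x) =
    dcoset (range (vmapB (pv_base x))) (ter_elt (pv_base x) (einv (peB h)) a)
      (range (mVg muC (pvC x))).
Proof. by case=> b hb <-; rewrite ter_elt_mbar; apply: pe_org. Qed.

Definition pedge_inv (x y : pvert) (h : pedge x y) : pedge y x :=
  PEdge (@pedge_inv_org x y h) (@pedge_inv_ter x y h).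

Lemma pedge_ext (x y : pvert) (h h' : pedge x y) (eB : peB h = peB h')
    (eC : peC h = peC h') :
  (forall a, dc_set (pe_dc h) a ->
     dc_set (pe_dc h') (gEcast (congr1 (fun g => Edge (mE muC g)) eC) a)) ->
  (forall a, dc_set (pe_dc h') (gEcast (congr1 (fun g => Edge (mE muC g)) eC) a)
     -> dc_set (pe_dc h) a) ->
  h = h'.
Proof.
case: h h' eB eC => [f g q D o t] [f' g' q' D' o' t'] /= eB eC.
case: f' / eB q' D' o' t'; case: g' / eC => q' D' o' t' /= DD' D'D.
rewrite (Prop_irrelevance q' q) in D' o' t' DD' D'D *.
have {DD' D'D} eD : D = D'.
  case: D D' {o t o' t'} DD' D'D => [D p] [D' p'] /= DD' D'D.
  have eD : D = D' by apply/seteqP; split.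
  by case: D' / eD p' {DD' D'D} => p'; rewrite (Prop_irrelevance p p').
by case: D' / eD o' t' => o' t';
  rewrite (Prop_irrelevance o o') (Prop_irrelevance t t').
Qed.

Fact pedge_invK (x y : pvert) (h : pedge x y) : pedge_inv (pedge_inv h) = h.
Proof.
apply: (@pedge_ext x y (pedge_inv (pedge_inv h)) h (einvK (peB h))
  (einvK (peC h))) => a /=.
  by case=> _ [b hb <-] <-; rewrite mbarK.
set r := congr1 _ _ => ha; exists (mbar muC _ (gEcast r a)).
  by exists (gEcast r a).
by apply: (@gEcast_inj _ _ _ _ _ _ _ r); rewrite mbarK.
Qed.

Fact pedge_inv_neq (x : pvert) (h : pedge x x) : pedge_inv h <> h.
Proof. by move=> /(congr1 (@peB x x)) /einv_neq. Qed.

Lemma dcosetMl (G : groupType) (H K : set G) (a h k : G) :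
    H h -> K k -> (forall x y, H x -> H y -> H (x / y)) ->
    (forall x y, K x -> K y -> K (x / y)) ->
  dcoset H (h * a * k) K = dcoset H a K.
Proof.
move=> Hh Kk HF KF.
have H1 : H 1 by rewrite -(mulgV h); apply: HF.
have K1 : K 1 by rewrite -(mulgV k); apply: KF.
have HV x : H x -> H x^-1 by move=> ?; rewrite -[x^-1]mul1g; apply: HF.
have KV x : K x -> K x^-1 by move=> ?; rewrite -[x^-1]mul1g; apply: KF.
have HM x y : H x -> H y -> H (x * y).
  by move=> ? ?; rewrite -[y]invgK; apply/HF/HV.
have KM x y : K x -> K y -> K (x * y).
  by move=> ? ?; rewrite -[y]invgK; apply/KF/KV.
apply/seteqP; split => _ [h' Hh' [k' Kk' ->]].
  by exists (h' * h); [exact: HM|exists (k * k'); [exact: KM|rewrite !mulgA]].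
exists (h' / h); first exact: HF.
exists (k^-1 * k'); first exact/KM/Kk'/KV.
by rewrite !mulgA mulgVK mulgK.
Qed.

Lemma range_ghomF (G H : groupType) (m : {ghom G -> H}) (x y : H) :
  range m x -> range m y -> range m (x / y).
Proof. by case=> a _ <- [b _ <-]; exists (a / b); rewrite ?gmulfF. Qed.

(* Every double coset in E_{f,g} is an edge of the product: its origin and its
   terminus do not depend on the choice of an element of the double coset. *)
Lemma org_elt_dcoset (v v' : B) (w w' : C) (p : muB v = muC w)
    (f : hedge v v') (g : hedge w w')
    (q : Edge (mE muB f) = Edge (mE muC g)) (D : edc q) a a' :
  dc_set D a -> dc_set D a' ->
  dcoset (range (vmapB p)) (org_elt p f a) (range (mVg muC w)) =
  dcoset (range (vmapB p)) (org_elt p f a') (range (mVg muC w)).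
Proof.
case: D => D /= [d ->].
suff gen b : dcoset (range (emapB q)) d (range (mEg muC g)) b ->
    dcoset (range (vmapB p)) (org_elt p f b) (range (mVg muC w)) =
    dcoset (range (vmapB p)) (org_elt p f d) (range (mVg muC w)).
  by move=> /gen -> /gen ->.
case=> _ [x _ <-] [_ [y _ <-] ->].
rewrite -[RHS](@dcosetMl _ _ _ _ (vmapB p (galpha f x))
  (mVg muC w (galpha g y))); first last.
- exact: range_ghomF.
- exact: range_ghomF.
- by exists (galpha g y).
- by exists (galpha f x).
congr dcoset; rewrite /org_elt !gmulfM (gcast_galphaB p) malphaE !conjgE.
by rewrite !mulgA mulgV mul1g mulgK.
Qed.

Lemma ter_elt_dcoset (v v' : B) (w w' : C) (p : muB v' = muC w')
    (f : hedge v v') (g : hedge w w')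
    (q : Edge (mE muB f) = Edge (mE muC g)) (D : edc q) a a' :
  dc_set D a -> dc_set D a' ->
  dcoset (range (vmapB p)) (ter_elt p f a) (range (mVg muC w')) =
  dcoset (range (vmapB p)) (ter_elt p f a') (range (mVg muC w')).
Proof.
move=> Da Da'; rewrite -!org_elt_mbar.
by apply: (@org_elt_dcoset _ _ _ _ p _ _ _ (edc_inv D)); [exists a|exists a'].
Qed.

Definition pbase (v : B) (w : C) (p : muB v = muC w) : pvert :=
  PVert (DoubleCoset (ex_intro (fun a => dcoset (range (vmapB p)) 1
    (range (mVg muC w)) = dcoset (range (vmapB p)) a (range (mVg muC w)))
    1 erefl)).

Definition product_graph : graph :=
  @Graph pvert pedge pedge_inv pedge_invK pedge_inv_neq.

(* The choices entering the definition of the product: the representatives of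
   the double cosets and the elements b_h and c_h. *)
Record product_choice := ProductChoice {
  vrep : forall x : pvert, gV (muC (pvC x));
  vrepP : forall x : pvert, dc_set (pv_dc x) (vrep x);
  erep : forall (x y : pvert) (h : pedge x y), gE (mE muC (peC h));
  erepP : forall (x y : pvert) (h : pedge x y), dc_set (pe_dc h) (erep h);
  erep_inv : forall (x y : pvert) (h : pedge x y),
    erep (pedge_inv h) = mbar muC (peC h) (erep h);
  bel : forall x y : pvert, pedge x y -> gV (pvB x);
  cel : forall x y : pvert, pedge x y -> gV (pvC x);
  vrepE : forall (x y : pvert) (h : pedge x y),
    vrep x = vmapB (pv_base x) (bel h) * org_elt (pv_base x) (peB h) (erep h)
             * (mVg muC (pvC x) (cel h))^-1 }.

End Product.

Section ProductChoiceExists.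
Variables (B C A : graph_of_groups).
Variables (muB : morphism B A) (muC : morphism C A).

Fact dc_ex (G : groupType) (H K : set G) (D : double_coset H K) :
  H 1 -> K 1 -> exists a, dc_set D a.
Proof.
case: D => D /= [a ->] H1 K1; exists a, 1 => //; exists 1 => //.
by rewrite mul1g mulg1.
Qed.

Fact range1 (G H : groupType) (m : {ghom G -> H}) : range m 1.
Proof. by exists 1 => //; rewrite gmulf1. Qed.

Let dcx (G H K : groupType) (m : {ghom G -> K}) (n : {ghom H -> K})
  (D : double_coset (range m) (range n)) : {a | dc_set D a}.
Proof. by apply: cid; apply: dc_ex; apply: range1. Qed.

Local Notation TE := {x : pvert muB muC & {y : pvert muB muC & pedge x y}}.
Let tot (x y : pvert muB muC) (h : pedge x y) : TE := existT _ x (existT _ y h).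
Let pr (x y : pvert muB muC) (h : pedge x y) : set TE :=
  [set t | t = tot h \/ t = tot (pedge_inv h)].
Let prE (x y : pvert muB muC) (h : pedge x y) : pr (pedge_inv h) = pr h.
Proof. by apply/seteqP; split => t; rewrite /pr /= pedge_invK => -[]; tauto. Qed.
Let gen (P : set TE) : option TE :=
  match pselect (exists t, P t) with
  | left e => Some (projT1 (cid e))
  | right _ => None
  end.
Let orient (x y : pvert muB muC) (h : pedge x y) : bool := `[< gen (pr h) = Some (tot h) >].

Let orient_inv (x y : pvert muB muC) (h : pedge x y) : orient (pedge_inv h) = ~~ orient h.
Proof.
rewrite /orient prE.
have : exists2 t, gen (pr h) = Some t & pr h t.
  rewrite /gen; case: pselect => [e|]; last by case; exists (tot h); left.
  by exists (projT1 (cid e)) => //; case: cid.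
have ne : tot h <> tot (pedge_inv h).
  move=> e.
  have exy : x = y by have := congr1 (@projT1 _ _) e.
  case: y / exy h e => h e; apply: (@pedge_inv_neq _ _ _ _ _ _ h).
  have e1 := Eqdep.EqdepTheory.inj_pair2 _ _ _ _ _ e.
  by have := Eqdep.EqdepTheory.inj_pair2 _ _ _ _ _ e1.
case=> t -> [] ->.
  rewrite (asboolT erefl) /=; apply/asboolP => /Some_inj; exact: ne.
rewrite (asboolT erefl) /=; symmetry; apply/negP => /asboolP /Some_inj e.
exact/ne/esym.
Qed.

Let e0 (x y : pvert muB muC) (h : pedge x y) : gE (mE muC (peC h)) := sval (dcx (pe_dc h)).
Let e0P (x y : pvert muB muC) (h : pedge x y) : dc_set (pe_dc h) (e0 h).
Proof. by rewrite /e0; case: dcx. Qed.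

Let rK (w w' : C) (g : hedge w w') :
  Edge (mE muC (einv (einv g))) = Edge (mE muC g).
Proof. by rewrite einvK. Qed.

Let e1 (x y : pvert muB muC) (h : pedge x y) : gE (mE muC (peC h)) :=
  if orient h then e0 h else
    gEcast (rK (peC h)) (mbar muC (einv (peC h)) (e0 (pedge_inv h))).

(* Choices as in [product_choice] exist, and the representative of the base
   point can be taken to be 1. *)
Lemma product_choice_exists (v0 : B) (w0 : C) (p : muB v0 = muC w0) :
  exists ch : product_choice muB muC, vrep ch (pbase p) = 1.
Proof.
have e1P (x y : pvert muB muC) (h : pedge x y) : dc_set (pe_dc h) (e1 h).
  rewrite /e1; case: orient; first exact: e0P.
  by have [b hb /= <-] := e0P (pedge_inv h); rewrite mbarK.
have e1inv (x y : pvert muB muC) (h : pedge x y) : e1 (pedge_inv h) = mbar muC (peC h) (e1 h).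
  rewrite /e1 orient_inv; case: orient => /=.
    have gen' h' (e : h' = h)
        (r : Edge (mE muC (einv (peC h'))) = Edge (mE muC (einv (peC h)))) :
        gEcast r (mbar muC (peC h') (e0 h')) = mbar muC (peC h) (e0 h).
      by case: _ / (esym e) r => r; rewrite /gEcast gcast_id.
    exact: gen' (pedge_invK h) _.
  apply: (@galpha_inj A); rewrite galpha_mbar -(gEcast_gomega _ erefl) /=.
  by rewrite gomega_mbar.
have vx (x : pvert muB muC) : {a | dc_set (pv_dc x) a & x = pbase p -> a = 1}.
  case: (pselect (x = pbase p)) => [->|n].
    exists 1 => //; exists 1; first exact: range1.
    by exists 1; [exact: range1|rewrite !mulg1].
  by have [a ha] := dcx (pv_dc x); exists a.
have bc (x y : pvert muB muC) (h : pedge x y) : {bc : gV (pvB x) * gV (pvC x) |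
   s2val (vx x) = vmapB (pv_base x) bc.1 * org_elt (pv_base x) (peB h) (e1 h)
             * (mVg muC (pvC x) bc.2)^-1 }.
  apply: cid; case: (vx x) => a /= + _.
  rewrite (pe_org (e1P _ _ h)) => -[_ [b _ <-] [_ [c _ <-] ->]].
  by exists (b, c^-1); rewrite gmulfV invgK.
unshelve eexists.
  exact: (@ProductChoice _ _ _ _ _ (fun x => s2val (vx x))
   (fun x => s2valP (vx x)) e1 e1P e1inv (fun x y h => (sval (bc x y h)).1)
   (fun x y h => (sval (bc x y h)).2)
   (fun x y h => svalP (bc x y h))).
exact: s2valP' (vx (pbase p)) erefl.
Qed.
End ProductChoiceExists.

Section ProductGroups.
Variables (B C A : graph_of_groups).
Variables (muB : morphism B A) (muC : morphism C A).
Variable ch : product_choice muB muC.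
Local Notation D := (product_graph muB muC).

Definition pgV (x : D) : groupType :=
  fiberprod (vmapB (pv_base x)) (mVg muC (pvC x)) (vrep ch x).

Definition pgE (x y : D) (h : hedge x y) : groupType :=
  fiberprod (emapB (pe_base h)) (mEg muC (peC h)) (erep ch h).

Fact palpha_subproof (x y : D) (h : hedge x y) (z : pgE h) :
  fiberprod_pred (vmapB (pv_base x)) (mVg muC (pvC x)) (vrep ch x)
    (galpha (peB h) (fpval z).1 ^ (bel ch h)^-1,
     galpha (peC h) (fpval z).2 ^ (cel ch h)^-1).
Proof.
have /eqP := fpvalP z; case: {z}(fpval z) => b c /=.
rewrite -mulgA -conjgE => hz; apply/eqP => /=.
rewrite -mulgA -[LHS]/((vmapB (pv_base x) _) ^ _) (vrepE ch h) /org_elt.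
rewrite gmulfJ gmulfV !conjgM conjgKV -(gcast_galphaB _ (pe_base h)).
by rewrite -gmulfJ hz malphaE conjgK gmulfJ gmulfV.
Qed.

Definition palpha (x y : D) (h : hedge x y) (z : pgE h) : pgV x :=
  FiberProd (palpha_subproof z).

Fact palphaF (x y : D) (h : hedge x y) : {morph @palpha x y h : z t / z / t}.
Proof.
move=> z t; apply/val_inj; rewrite /= gmulfF /=.
by rewrite !gmulfF !conjMg !conjVg.
Qed.

HB.instance Definition _ (x y : D) (h : hedge x y) :=
  isGroupMorphism.Build (pgE h) (pgV x) (@palpha x y h) (@palphaF x y h).

Fact pbar_subproof (x y : D) (h : hedge x y) (z : pgE h) :
  fiberprod_pred (emapB (pe_base (einv h))) (mEg muC (peC (einv h)))
    (erep ch (einv h)) (ebar (fpval z).1, ebar (fpval z).2).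
Proof.
have /eqP := fpvalP z; case: {z}(fpval z) => b c /= hz; apply/eqP => /=.
have /= -> := emapB_inv (pe_base h) b.
by rewrite mbarE erep_inv -gmulfV -!gmulfM hz.
Qed.

Definition pbar (x y : D) (h : hedge x y) (z : pgE h) : pgE (einv h) :=
  FiberProd (pbar_subproof z).

Fact pbarF (x y : D) (h : hedge x y) : {morph @pbar x y h : z t / z / t}.
Proof. by move=> z t; apply/val_inj; rewrite /= !gmulfF. Qed.

HB.instance Definition _ (x y : D) (h : hedge x y) :=
  isGroupMorphism.Build (pgE h) (pgE (einv h)) (@pbar x y h) (@pbarF x y h).

Definition pomega (x y : D) (h : hedge x y) : {ghom pgE h -> pgV y} :=
  @palpha y x (einv h) \o @pbar x y h.

Fact palpha_inj (x y : D) (h : hedge x y) : injective (@palpha x y h).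
Proof.
move=> z t /(congr1 (@fpval _ _ _ _ _ _)) [] /conjg_inj/galpha_inj e1.
by move=> /conjg_inj/galpha_inj e2; apply/val_inj/injective_projections.
Qed.

Fact ebar_inj (X : graph_of_groups) (u v : X) (e : hedge u v) :
  injective (@ebar X u v e).
Proof. by move=> a b ab; apply: (@galpha_inj X); rewrite !galphaE ab. Qed.

Fact pomega_inj (x y : D) (h : hedge x y) : injective (pomega h).
Proof.
move=> z t /palpha_inj /(congr1 (@fpval _ _ _ _ _ _)) [] /ebar_inj e1.
by move=> /ebar_inj e2; apply/val_inj/injective_projections.
Qed.

Fact pomegaE (x y : D) (h : hedge x y) (z : pgE h) :
  pomega h z = palpha (pbar z).
Proof. by []. Qed.

Fact palphaE (x y : D) (h : hedge x y) (z : pgE h) :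
  palpha z = pomega (einv h) (pbar z).
Proof.
rewrite pomegaE; apply/val_inj => /=.
rewrite -!gomegaE -!galphaE.
by rewrite pedge_invK.
Qed.

Definition product : graph_of_groups :=
  GraphOfGroups palpha_inj pomega_inj pomegaE palphaE.


End ProductGroups.

Section Projections.
Variables (B C A : graph_of_groups).
Variables (muB : morphism B A) (muC : morphism C A).
Variable ch : product_choice muB muC.
Local Notation D := (product ch).

Definition rhoBV (x : D) (z : pgV ch x) : gV (pvB x) := (fpval z).1.
Definition rhoCV (x : D) (z : pgV ch x) : gV (pvC x) := (fpval z).2.
Definition rhoBE (x y : D) (h : hedge x y) (z : pgE ch h) : gE (peB h) :=
  (fpval z).1.
Definition rhoCE (x y : D) (h : hedge x y) (z : pgE ch h) : gE (peC h) :=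
  (fpval z).2.

Fact rhoBVF (x : D) : {morph @rhoBV x : z t / z / t}. Proof. by []. Qed.
Fact rhoCVF (x : D) : {morph @rhoCV x : z t / z / t}. Proof. by []. Qed.
Fact rhoBEF (x y : D) (h : hedge x y) : {morph @rhoBE x y h : z t / z / t}.
Proof. by []. Qed.
Fact rhoCEF (x y : D) (h : hedge x y) : {morph @rhoCE x y h : z t / z / t}.
Proof. by []. Qed.

HB.instance Definition _ (x : D) :=
  isGroupMorphism.Build (pgV ch x) (gV (pvB x)) (@rhoBV x) (@rhoBVF x).
HB.instance Definition _ (x : D) :=
  isGroupMorphism.Build (pgV ch x) (gV (pvC x)) (@rhoCV x) (@rhoCVF x).
HB.instance Definition _ (x y : D) (h : hedge x y) :=
  isGroupMorphism.Build (pgE ch h) (gE (peB h)) (@rhoBE x y h) (@rhoBEF x y h).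
HB.instance Definition _ (x y : D) (h : hedge x y) :=
  isGroupMorphism.Build (pgE ch h) (gE (peC h)) (@rhoCE x y h) (@rhoCEF x y h).

Fact fiberprod_fst_inj (G H K : groupType) (m : {ghom G -> K})
    (n : {ghom H -> K}) (k : K) (z t : fiberprod m n k) :
  injective n -> (fpval z).1 = (fpval t).1 -> z = t.
Proof.
move=> n_inj e1; apply/val_inj/injective_projections => //.
by apply: n_inj; rewrite -(eqP (fpvalP z)) -(eqP (fpvalP t)) e1.
Qed.

Fact fiberprod_snd_inj (G H K : groupType) (m : {ghom G -> K})
    (n : {ghom H -> K}) (k : K) (z t : fiberprod m n k) :
  injective m -> (fpval z).2 = (fpval t).2 -> z = t.
Proof.
move=> m_inj e2; apply/val_inj/injective_projections => //.
apply/m_inj/(mulgI k^-1)/(mulIg k).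
by rewrite (eqP (fpvalP z)) (eqP (fpvalP t)) e2.
Qed.

Fact rhoBV_inj (x : D) : injective (@rhoBV x).
Proof. by move=> z t; apply: fiberprod_fst_inj; apply: mVg_inj. Qed.
Fact rhoCV_inj (x : D) : injective (@rhoCV x).
Proof. by move=> z t; apply: fiberprod_snd_inj; apply: vmapB_inj. Qed.
Fact rhoBE_inj (x y : D) (h : hedge x y) : injective (@rhoBE x y h).
Proof. by move=> z t; apply: fiberprod_fst_inj; apply: mEg_inj. Qed.
Fact rhoCE_inj (x y : D) (h : hedge x y) : injective (@rhoCE x y h).
Proof. by move=> z t; apply: fiberprod_snd_inj; apply: emapB_inj. Qed.

Fact rhoB_inv (x y : D) (h : hedge x y) : peB (einv h) = einv (peB h).
Proof. by []. Qed.
Fact rhoC_inv (x y : D) (h : hedge x y) : peC (einv h) = einv (peC h).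
Proof. by []. Qed.

Let omega_twB (x y : D) (h : hedge x y) : gV (pvB y) := bel ch (einv h).
Let omega_twC (x y : D) (h : hedge x y) : gV (pvC y) := cel ch (einv h).

Fact rhoB_twa_inv (x y : D) (h : hedge x y) :
  bel ch (einv h) = omega_twB h.
Proof. by []. Qed.
Fact rhoC_twa_inv (x y : D) (h : hedge x y) :
  cel ch (einv h) = omega_twC h.
Proof. by []. Qed.
Fact rhoB_two_inv (x y : D) (h : hedge x y) :
  omega_twB (einv h) = bel ch h.
Proof. by rewrite /omega_twB einvK. Qed.
Fact rhoC_two_inv (x y : D) (h : hedge x y) :
  omega_twC (einv h) = cel ch h.
Proof. by rewrite /omega_twC einvK. Qed.

Fact rhoB_alpha (x y : D) (h : hedge x y) (z : gE h) :
  galpha (peB h) (rhoBE z) = rhoBV (galpha h z) ^ bel ch h.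
Proof. by rewrite /= /rhoBV /= conjgKV. Qed.
Fact rhoC_alpha (x y : D) (h : hedge x y) (z : gE h) :
  galpha (peC h) (rhoCE z) = rhoCV (galpha h z) ^ cel ch h.
Proof. by rewrite /= /rhoCV /= conjgKV. Qed.
Fact rhoB_omega (x y : D) (h : hedge x y) (z : gE h) :
  gomega (peB h) (rhoBE z) = rhoBV (gomega h z) ^ omega_twB h.
Proof. by rewrite gomegaE /= /rhoBV /= conjgKV. Qed.
Fact rhoC_omega (x y : D) (h : hedge x y) (z : gE h) :
  gomega (peC h) (rhoCE z) = rhoCV (gomega h z) ^ omega_twC h.
Proof. by rewrite gomegaE /= /rhoCV /= conjgKV. Qed.

Definition rhoB : morphism D B :=
  Morphism rhoB_inv rhoBV_inj rhoBE_inj rhoB_twa_inv rhoB_two_inv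
    rhoB_alpha rhoB_omega.
Definition rhoC : morphism D C :=
  Morphism rhoC_inv rhoCV_inj rhoCE_inj rhoC_twa_inv rhoC_two_inv
    rhoC_alpha rhoC_omega.

End Projections.

(* Main.v *)
Require Import Defs.
From mathcomp Require Import all_boot.
From mathcomp Require Import boolp classical_sets.

Set Implicit Arguments.
Unset Strict Implicit.
Unset Printing Implicit Defensive.

Local Open Scope classical_set_scope.
Local Open Scope group_scope.

(** A path [P] of the product from [x] to [y] has two images in [A], one through
    [B] and one through [C], and the representatives of the double cosets [x]
    and [y] intertwine them: [muB(rhoB(P)) y~ = x~ muC(rhoC(P))]
    ([product_path_twist]). For circuits at [x] this says that the two images of
    the fundamental group are conjugate under [x~]; as they are contained in the
    images of the fundamental groups of [B] and [C], the inclusion follows.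

    For the equality, an element of the intersection is given by a circuit [pb]
    of [B] and a circuit [pc] of [C] with [muB(pb) x~ = x~ muC(pc)], and both
    circuits can be chosen reduced ([reduced_repr]). Immersions preserve
    reducedness ([reduced_gpmap]). By the normal form theorem
    ([peq_reduced_slides]), reduced paths that are equal in the fundamental
    groupoid have the same edges and are obtained from each other by moving
    elements of edge groups across these edges. Each such element spans
    a double coset, which is an edge of the product, and these edges form a
    circuit at [x] that projects to [pb] and [pc] ([product_path_lift]).

    The normal form theorem is proved by letting the groupoid act on reduced
    paths up to these moves, in the manner of van der Waerden: the action
    satisfies the defining relations, and a reduced path acts on the trivial
    path by returning itself.

    The pointed version is the case where the representative is [1]. The last
    part follows by conjugating with the image of the path in [C], since
    conjugation by the image of a path from [v0] to [v] takes the image of the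
    fundamental group at [v0] to the image of the one at [v]. *)

(** * Normal forms in the fundamental groupoid *)

Section NormalForm.
Variable A : graph_of_groups.

(** The intermediate vertex is an index of the type of the tail, so the tails
    are compared through the trivial path between the two vertices. *)
Lemma pcons_inj (u v v' w : A) (a a' : gV u) (e : hedge u v) (e' : hedge u v')
    (p : gpath v w) (p' : gpath v' w) :
  pcons a e p = pcons a' e' p' ->
  exists r : v = v', [/\ a = a', Edge e = Edge e' &
    p = pcat (vpath r 1) p'].
Proof.
pose after u w1 : Type := option {z : A & (hedge u z * gpath z w1)%type}.
pose head w1 (q : gpath u w1) : after u w1 :=
  match q in gpath u w1 return after u w1 with
  | pnil _ _ => None
  | pcons _ z _ _ e q => Some (existT _ z (e, q))
  end.
pose elt w1 (q : gpath u w1) : gV u :=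
  match q in gpath u w1 return gV u with
  | pnil _ a => a | pcons _ _ _ a _ _ => a end.
move=> E; have aa' : a = a' := congr1 (@elt w) E.
have {E} /Some_inj E := congr1 (@head w) E.
have r : v = v' := congr1 (@projT1 _ _) E.
exists r; case: v' / r e' p' E => e' p' E.
have [-> ->] := Eqdep.EqdepTheory.inj_pair2 _ _ _ _ _ E.
by split=> //=; rewrite lmul1.
Qed.

Lemma pcons_inj_same (u v w : A) (a a' : gV u) (e : hedge u v)
    (p p' : gpath v w) :
  pcons a e p = pcons a' e p' -> a = a' /\ p = p'.
Proof.
by case/pcons_inj=> r [-> _ ->]; rewrite (Prop_irrelevance r erefl) /= lmul1.
Qed.

Lemma Edge_inj (u v : A) (e e' : hedge u v) : Edge e = Edge e' -> e = e'.
Proof.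
pose f (d : edge A) : {x : A & {y : A & hedge x y}} :=
  existT _ _ (existT _ _ (earr d)).
move=> /(congr1 f) E; apply: (Eqdep.EqdepTheory.inj_pair2 _ (hedge u)).
exact: (Eqdep.EqdepTheory.inj_pair2 _ _ _ _ _ E).
Qed.

Lemma ebar_surj (u v : A) (e : hedge u v) (z : gE (einv e)) :
  exists y : gE e, z = ebar y.
Proof.
exists (gEcast (congr1 Edge (einvK e)) (ebar z)).
apply: (@galpha_inj A); rewrite -gomegaE.
by rewrite -(gEcast_gomega _ erefl) /= galphaE.
Qed.

(** Equality in the fundamental groupoid without insertion or cancellation of
    edges: only elements of the edge groups are moved across the edges. On
    reduced paths this turns out to be all of the equality. *)
Fixpoint slides (u w : A) (p : gpath u w) : gpath u w -> Prop :=
  match p in gpath u w return gpath u w -> Prop with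
  | pnil u a => fun q => q = pnil a
  | pcons u v w a e p => fun q => exists s q',
      q = pcons (a * galpha e s) e q' /\ slides p (lmul q' (gomega e s))
  end.

Lemma lmulK (u v : A) (p : gpath u v) a : lmul (lmul p a) a^-1 = p.
Proof. by rewrite -lmulM mulVg lmul1. Qed.

Lemma slides_refl (u w : A) (p : gpath u w) : slides p p.
Proof.
elim: p => [x a|x v w' a e p IH] //=.
by exists 1, p; rewrite !gmulf1 mulg1 lmul1.
Qed.

Lemma slides_lmul (u w : A) (p q : gpath u w) a :
  slides p q -> slides (lmul p a) (lmul q a).
Proof.
case: p q a => [x b|x v w' b e p] q a /= => [-> //|].
by case=> s [q' [-> pq']]; exists s, q'; rewrite /= mulgA.
Qed.

Lemma slides_sym (u w : A) (p q : gpath u w) : slides p q -> slides q p.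
Proof.
elim: p q => [x a|x v w' a e p IH] q /= => [-> //|].
case=> s [q' [-> pq']]; exists s^-1, p; split.
  by rewrite gmulfV mulgK.
by rewrite gmulfV -[q'](lmulK _ (gomega e s)); apply/slides_lmul/IH.
Qed.

Lemma slides_trans (u w : A) (p q r : gpath u w) :
  slides p q -> slides q r -> slides p r.
Proof.
elim: p q r => [x a|x v w' a e p IH] q r /= => [-> //|].
case=> s [q' [-> pq']] /= [t [r' [-> q'r']]].
exists (s * t), r'; split; first by rewrite gmulfM mulgA.
by apply: IH pq' _; rewrite gmulfM lmulM; apply: slides_lmul.
Qed.

Definition backtracks (u v w : A) (e : hedge u v) (p : gpath v w) (s : gE e)
    (q : gpath u w) : Prop :=
  p = pcons (gomega e s) (einv e) q.

Lemma backtracks_inj (u v w : A) (e : hedge u v) (p : gpath v w) s s' q q' :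
  @backtracks u v w e p s q -> backtracks p s' q' -> s = s' /\ q = q'.
Proof.
by rewrite /backtracks => -> /pcons_inj_same[/gomega_inj -> ->].
Qed.

(** This form of reducedness only involves edges with the same endpoints. *)
Lemma reduced_afterP (u v w : A) (e : hedge u v) (p : gpath v w) :
  reduced_after e p <-> forall s q, ~ @backtracks u v w e p s q.
Proof.
split; rewrite /backtracks.
  by move=> + s q pE; rewrite pE /= => /(_ erefl); apply; exists s.
case: p e => [x a|x v' w' a e' p] e //= H E.
have r : v' = u := congr1 (@etgt A) E.
case: u / r e H E => e H E.
have {}E : e' = einv e.
  exact: Edge_inj.
by case=> s _ sa; apply: (H s p); rewrite E sa.
Qed.

Lemma reduced_lmul (u v : A) (p : gpath u v) a :
  reduced (lmul p a) <-> reduced p.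
Proof. by case: p a. Qed.

Lemma reduced_after_lmul (u v w : A) (e : hedge u v) (p : gpath v w) s :
  reduced_after e p -> reduced_after e (lmul p (gomega e s)).
Proof.
case: p e s => [x a|x v' w' a e' p] e s //= H /H {}H [t _ ta]; apply: H.
by exists (s^-1 * t) => //; rewrite gmulfM gmulfV ta mulKg.
Qed.

Lemma reduced_after_slides (u v w : A) (e : hedge u v) (p q : gpath v w) :
  slides p q -> reduced_after e p -> reduced_after e q.
Proof.
move=> pq /reduced_afterP pr; apply/reduced_afterP => s q'.
rewrite /backtracks => qE; move: (slides_sym pq).
rewrite qE /= => -[t [p' [pE _]]].
have [y tE] := ebar_surj t.
by apply: (pr (s * y) p'); rewrite /backtracks pE tE -gomegaE -gmulfM.
Qed.

(** The left action of the generator [(1, e, 1)] of the groupoid on the reduced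
    paths: [e] cancels against a backtracking, and is put in front otherwise. *)
Definition edge_act (u v w : A) (e : hedge u v) (p : gpath v w) : gpath u w :=
  match pselect (exists sq, @backtracks u v w e p sq.1 sq.2) with
  | left h => lmul (sval (cid h)).2 (galpha e (sval (cid h)).1)
  | right _ => pcons 1 e p
  end.

Lemma edge_act_back (u v w : A) (e : hedge u v) s (q : gpath u w) :
  edge_act e (pcons (gomega e s) (einv e) q) = lmul q (galpha e s).
Proof.
rewrite /edge_act; case: pselect => [h|]; last by case; exists (s, q).
by have [-> ->] := backtracks_inj (svalP (cid h)) erefl.
Qed.

Lemma edge_act_reduced_after (u v w : A) (e : hedge u v) (p : gpath v w) :
  reduced_after e p -> edge_act e p = pcons 1 e p.
Proof.
move=> /reduced_afterP pr; rewrite /edge_act; case: pselect => // h.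
by have [[s q] /pr] := h.
Qed.

Variant edge_act_spec (u v w : A) (e : hedge u v) (p : gpath v w) :
    gpath u w -> Prop :=
| EdgeActBack s q of p = pcons (gomega e s) (einv e) q :
    edge_act_spec e p (lmul q (galpha e s))
| EdgeActReduced of reduced_after e p : edge_act_spec e p (pcons 1 e p).

Lemma edge_actP (u v w : A) (e : hedge u v) (p : gpath v w) :
  edge_act_spec e p (edge_act e p).
Proof.
have [[[s q] /= pE]|n] := pselect (exists sq, @backtracks u v w e p sq.1 sq.2).
  by rewrite pE edge_act_back; constructor.
have pr : reduced_after e p.
  by apply/reduced_afterP => s q pE; apply: n; exists (s, q).
by rewrite edge_act_reduced_after //; constructor.
Qed.

Lemma edge_act_reduced (u v w : A) (e : hedge u v) (p : gpath v w) :
  reduced p -> reduced (edge_act e p).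
Proof. by case: edge_actP => [s q -> [_ qr]|]; rewrite ?reduced_lmul. Qed.

Lemma edge_act_slides (u v w : A) (e : hedge u v) (p q : gpath v w) :
  slides p q -> slides (edge_act e p) (edge_act e q).
Proof.
move=> pq; case: (edge_actP e p) => [s p' pE|pr]; last first.
  rewrite edge_act_reduced_after; last exact: reduced_after_slides pr.
  by exists 1, q; rewrite !gmulf1 mulg1 lmul1.
move: pq; rewrite pE /= => -[t [q' [-> p'q']]].
have [y tE] := ebar_surj t; rewrite tE -gomegaE -gmulfM edge_act_back.
by rewrite gmulfM lmulM; apply: slides_lmul; rewrite galphaE -tE.
Qed.

(** The defining relation of the fundamental groupoid holds for the action on
    reduced paths, up to sliding. *)
Lemma edge_act_edge (u v w : A) (e : hedge u v) x (p : gpath u w) :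
  reduced p ->
  slides (edge_act e (lmul (edge_act (einv e) p) (gomega e x)))
         (lmul p (galpha e x)).
Proof.
move=> pr; case: (edge_actP (einv e) p) => [s q pE|par]; last first.
  by rewrite /= mulg1 edge_act_back; apply: slides_refl.
have [y sE] := ebar_surj s.
move: pE pr; rewrite sE -galphaE -gomegaE einvK => -> /= [qa qr].
rewrite -lmulM -gmulfM edge_act_reduced_after; last exact: reduced_after_lmul.
exists (x * y), q; split; last exact: slides_refl.
by rewrite gmulfM mul1g.
Qed.

Fixpoint path_act (u v w : A) (p : gpath u v) : gpath v w -> gpath u w :=
  match p in gpath u v return gpath v w -> gpath u w with
  | pnil u a => fun r => lmul r a
  | pcons u v _ a e p => fun r => lmul (edge_act e (path_act p r)) a
  end.

Lemma path_act_lmul (u v w : A) (p : gpath u v) (r : gpath v w) a :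
  path_act (lmul p a) r = lmul (path_act p r) a.
Proof. by case: p r a => [x b|x v' w' b e p] r a /=; rewrite lmulM. Qed.

Lemma path_act_cat (u v w z : A) (p : gpath u v) (q : gpath v w)
    (r : gpath w z) :
  path_act (pcat p q) r = path_act p (path_act q r).
Proof.
by elim: p q => [x a|x v' w' a e p IH] q /=; rewrite ?path_act_lmul ?IH.
Qed.

Lemma path_act_reduced (u v w : A) (p : gpath u v) (r : gpath v w) :
  reduced r -> reduced (path_act p r).
Proof.
elim: p r => [x a|x v' w' a e p IH] r rr /=; rewrite reduced_lmul //.
exact/edge_act_reduced/IH.
Qed.

Lemma path_act_slides (u v w : A) (p : gpath u v) (r r' : gpath v w) :
  slides r r' -> slides (path_act p r) (path_act p r').
Proof.
elim: p r r' => [x a|x v' w' a e p IH] r r' rr' /=; apply: slides_lmul => //.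
exact/edge_act_slides/IH.
Qed.

Lemma peq_path_act (u v w : A) (p q : gpath u v) (r : gpath v w) :
  peq p q -> reduced r -> slides (path_act p r) (path_act q r).
Proof.
move=> pq; elim: pq r => {u v p q} [u v p|u v p q _ IH|u v p q p' _ IH _ IH'
  |u v z p p' q q' _ IH _ IH'|u v e x] r rr.
- exact: slides_refl.
- exact/slides_sym/IH.
- exact: slides_trans (IH _ rr) (IH' _ rr).
- rewrite !path_act_cat; apply: slides_trans (path_act_slides _ (IH' _ rr)) _.
  exact/IH/path_act_reduced.
- by rewrite /= !lmul1; apply: edge_act_edge.
Qed.

Lemma path_act_id (u v : A) (p : gpath u v) :
  reduced p -> path_act p (pnil 1) = p.
Proof.
elim: p => [x a|x v' w' a e p IH] /=; first by rewrite mulg1.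
by case=> pa /IH ->; rewrite edge_act_reduced_after //= mulg1.
Qed.

(** Normal form theorem: equal paths act in the same way, and a reduced path is
    recovered from its action on the trivial path. *)
Lemma peq_reduced_slides (u v : A) (p q : gpath u v) :
  reduced p -> reduced q -> peq p q -> slides p q.
Proof.
move=> pr qr pq; rewrite -(path_act_id pr) -(path_act_id qr).
exact: peq_path_act.
Qed.

Lemma peq_lmul (u v : A) (p q : gpath u v) a :
  peq p q -> peq (lmul p a) (lmul q a).
Proof. by rewrite !(lmulE _ a) => pq; apply: peq_cat pq; apply: peq_refl. Qed.

(** Each slide is an equality in the fundamental groupoid: insert
    [(1, e, omega_e(s), e^-1, 1)] and cancel [e^-1] against [e]. *)
Lemma peq_shift (u v w : A) (a : gV u) (e : hedge u v) s (p : gpath v w) :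
  peq (pcons a e (lmul p (gomega e s))) (pcons (a * galpha e s) e p).
Proof.
have h := peq_cat (peq_edge s) (peq_refl (pcons 1 e p)).
have := peq_lmul a h; rewrite /= !mulg1 => /(peq_trans _); apply.
apply/peq_pcons; have := peq_edge (1 : gE (einv e)).
rewrite einvK !gmulf1 => h'.
have := peq_cat (peq_lmul (gomega e s) h') (peq_refl p).
rewrite /= lmul1 !mulg1 => h''; exact/peq_sym.
Qed.

Lemma peq_edge_act (u v w : A) (e : hedge u v) (p : gpath v w) :
  peq (edge_act e p) (pcons 1 e p).
Proof.
case: edge_actP => [s q ->|_]; last exact: peq_refl.
have := peq_cat (peq_edge s) (peq_refl q).
by rewrite /= lmul1 => /peq_sym.
Qed.

Lemma reduced_repr (u v : A) (x : phom u v) :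
  exists2 p, reduced p & x = pclass p.
Proof.
have [p ->] := pclass_surj x; exists (path_act p (pnil 1)).
  exact: path_act_reduced.
apply/pclassP/peq_sym; elim: p {x} => [x a|x v' w' a e p IH] /=.
  by rewrite mulg1; apply: peq_refl.
apply: peq_trans (peq_lmul a (peq_edge_act e _)) _ => /=.
by rewrite mulg1; apply: peq_pcons.
Qed.

End NormalForm.

(** * Immersions preserve reduced paths *)

Section Immersions.
Variables (B A : graph_of_groups) (mu : morphism B A).

Lemma range_galpha_einv (u v : A) (e : hedge u v) :
  range (galpha (einv e)) = range (gomega e).
Proof.
apply/seteqP; split=> _ [x _ <-].
  by have [y ->] := ebar_surj x; exists y => //; rewrite gomegaE.
by exists (ebar x) => //; rewrite -gomegaE.
Qed.

Lemma twa_Edge (u v v' : B) (f : hedge u v) (f' : hedge u v') :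
  Edge f = Edge f' -> twa mu f = twa mu f'.
Proof.
move=> E; have r : v = v' := congr1 (@etgt B) E.
by case: v' / r f' E => f' /Edge_inj ->.
Qed.

(** If the image of [(f, b, f')] can be backtracked, then [f'] and [f^-1] give
    the same double coset, so they are equal by the first condition on
    immersions; then the second condition puts [b] in the image of the edge
    group of [f]. *)
Lemma immersion_backtrack (v v1 v2 : B) (f : hedge v1 v) (f' : hedge v v2) b :
  immersion mu -> Edge (mE mu f') = Edge (einv (mE mu f)) ->
  range (gomega (mE mu f)) ((two mu f)^-1 * mVg mu v b * twa mu f') ->
  Edge f' = Edge (einv f) /\ range (gomega f) b.
Proof.
move=> [inj surj] q [x _ xE].
have q' : Edge (mE mu (einv f)) = Edge (mE mu f') by rewrite mE_inv q.
have fE : Edge (einv f) = Edge f'.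
  apply/(inj _ _ _ _ _ q').
  rewrite mE_inv range_galpha_einv twa_inv.
  have memB : range (mVg mu v) (mVg mu v b^-1) by exists b^-1.
  have memA : range (gomega (mE mu f)) (gomega (mE mu f) x) by exists x.
  rewrite -(dcosetMl (two mu f) memB memA (@range_ghomF _ _ _)
    (@range_ghomF _ _ _)).
  by rewrite xE gmulfV !mulgA mulgK mulVg mul1g.
split=> //.
have twE : twa mu f' = two mu f by rewrite -(twa_Edge fE) twa_inv.
have xA : range (galpha (mE mu (einv f))) (gomega (mE mu f) x).
  by rewrite mE_inv range_galpha_einv; exists x.
have xB : [set c ^ twa mu (einv f) | c in range (mVg mu v)]
    (gomega (mE mu f) x).
  exists (mVg mu v b); first by exists b.
  by rewrite xE twE twa_inv conjgE mulgA.
have : (galpha (mE mu (einv f)) @` range (mEg mu (einv f)))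
    (gomega (mE mu f) x) by rewrite surj.
case=> _ [z _ <-]; have [y ->] := ebar_surj z.
rewrite malphaE twa_inv -gomegaE xE twE -mulgA -conjgE.
by move=> /conjg_inj/mVg_inj <-; exists y.
Qed.

Lemma reduced_gpmap (u v : B) (p : gpath u v) :
  immersion mu -> reduced p -> reduced (gpmap mu p).
Proof.
move=> imm; elim: p => [x b|x y w b f p IH] //= [fp pr].
split; last exact/reduced_lmul/IH.
case: p f fp {IH pr} => [z c|z z' w' c f' p] //= f fp q.
 rewrite mulgA => /(immersion_backtrack imm q)[fE bE].
exact: (fp fE).
Qed.

End Immersions.

(** * Trivial paths between equal vertices *)

Section Transport.
Variable A : graph_of_groups.

Lemma pcat_vpath_lmul (u v w : A) (r : u = v) a (q : gpath v w) b :
  pcat (vpath r a) (lmul q b) = pcat (vpath r (a * b)) q.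
Proof. by case: v / r a q b => a q b /=; rewrite lmulM. Qed.

Lemma lmul_pcat_vpath (u v w : A) (r : u = v) a (q : gpath v w) b :
  lmul (pcat (vpath r a) q) b = pcat (vpath r (gcast gV r b * a)) q.
Proof. by case: v / r a q => a q /=; rewrite -lmulM. Qed.

Lemma lmul_vpath (u v : A) (r : u = v) a b :
  lmul (vpath r a) b = vpath r (gcast gV r b * a).
Proof. by case: v / r a. Qed.

Lemma pcat_vpath_pnil (u v : A) (r : u = v) a b :
  pcat (vpath r a) (pnil b) = vpath r (a * b).
Proof. by case: v / r a b. Qed.

(** Sliding across an edge [e] when [e] is known at two pairs of equal vertices,
    as the image of an edge of [B] and as that of an edge of [C]. *)
Lemma peq_edge_vpath (u v u' v' w : A) (e : hedge u v) (e' : hedge u' v')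
    (r : u = u') (t : v = v') (E : Edge e = Edge e') (s : gE e') a b
    (q : gpath v' w) :
  peq (pcons a e (pcat (vpath t (gomega e' s * b)) q))
      (pcat (vpath r (gcast gV r a * galpha e' s)) (pcons 1 e' (lmul q b))).
Proof.
case: u' / r e' E s => e' E s; case: v' / t e' E s q b.
move=> e' /Edge_inj <- s q b /=.
by rewrite mulg1 lmulM; apply: peq_shift.
Qed.

(** The first edges of related paths agree, which identifies their termini, and
    the rest of the paths is related after sliding an element [s] across. *)
Lemma slides_pcons_vpath (u v u' v' w : A) (e : hedge u v) (e' : hedge u' v')
    (r : u = u') a a' x (p : gpath v w) (q : gpath v' w) :
  slides (pcons a e p) (pcat (vpath r x) (pcons a' e' q)) ->
  exists (t : v = v') (E : Edge e = Edge e') (s : gE e'),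
    x * a' = gcast gV r a * galpha e' s /\
    slides p (pcat (vpath t (gomega e' s)) q).
Proof.
case: u' / r e' x a' => e' x a' /= [s [q' [/pcons_inj[t [-> E ->]] pq]]].
have tE := esym t; exists tE; case: v' / tE e' q t E pq => e' q t.
rewrite (Prop_irrelevance t erefl) => E; case/Edge_inj: (E) s => <- s.
rewrite /= lmul1 => pq.
by exists erefl, s.
Qed.

Lemma slides_pcons_pnil (u v u' : A) (e : hedge u v) (r : u = u')
    a x b (p : gpath v u') :
  ~ slides (pcons a e p) (pcat (vpath r x) (pnil b)).
Proof. by case: u' / r x b p => x b p [s [q []]]. Qed.

Lemma slides_vpath (u v : A) (r r' : u = v) a b :
  slides (vpath r a) (vpath r' b) -> a = b.
Proof.
case: v / r r' a b => r; rewrite (Prop_irrelevance r erefl) /= => a b.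
by move=> E; have := congr1 (fun p => if p is pnil _ a then a else 1) E.
Qed.

Lemma slides_vpath_pcons (u u' v w : A) (r : u = w) (t : u = u') a x b
   (e : hedge u' v) (q : gpath v w) :
  ~ slides (vpath r a) (pcat (vpath t x) (pcons b e q)).
Proof. by case: w / r a q => a q; case: u' / t x b e => x b e. Qed.

Lemma reduced_vpath_pcat (u v w : A) (r : u = v) a (q : gpath v w) :
  reduced q -> reduced (pcat (vpath r a) q).
Proof. by case: v / r a q => a q qr; apply/reduced_lmul. Qed.

Lemma reduced_pcat_vpath (u v w : A) (p : gpath u v) (r : v = w) a :
  reduced p -> reduced (pcat p (vpath r a)).
Proof.
case: w / r a => a /=; elim: p a => [x b|x v' w b e p IH] a //= [pa pr].
split; last exact: IH.
by case: p a e pa {IH pr} => [z c|z z' w' c e' p] a e.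
Qed.

End Transport.

(** * Paths in the product *)

Section ProductPaths.
Variables (B C A : graph_of_groups).
Variables (muB : morphism B A) (muC : morphism C A).

Lemma org_elt_mul (v v' : B) (w w' : C) (p : muB v = muC w)
    (f : hedge v v') (g : hedge w w')
    (E : Edge (mE muB f) = Edge (mE muC g)) b c s :
  org_elt p f (emapB E b * s * mEg muC g c) =
  vmapB p (galpha f b) * org_elt p f s * mVg muC w (galpha g c).
Proof.
rewrite /org_elt !gmulfM (gcast_galphaB p) malphaE !conjgE.
by rewrite !mulgA mulgV mul1g mulgK.
Qed.

Lemma ter_elt_mul (v v' : B) (w w' : C) (p : muB v' = muC w')
    (f : hedge v v') (g : hedge w w')
    (E : Edge (mE muB f) = Edge (mE muC g)) b c s :
  ter_elt p f (emapB E b * s * mEg muC g c) =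
  vmapB p (gomega f b) * ter_elt p f s * mVg muC w' (gomega g c).
Proof.
have E' : mbar muC g (emapB E b * s * mEg muC g c) =
    emapB (inv_base E) (ebar b) * mbar muC g s * mEg muC (einv g) (ebar c).
  by rewrite emapB_inv mbarE !gmulfM.
by rewrite -!org_elt_mbar E' org_elt_mul -!gomegaE.
Qed.

Lemma vdc_eq (v : B) (w : C) (p : muB v = muC w) (X : vdc p) a :
  dc_set X a -> dc_set X = dcoset (range (vmapB p)) a (range (mVg muC w)).
Proof.
case: X => X [d XE]; rewrite /dc_set XE => -[h hh [k kk ->]].
by rewrite (dcosetMl d hh kk (@range_ghomF _ _ _) (@range_ghomF _ _ _)).
Qed.

Lemma vdc_ext (v : B) (w : C) (p : muB v = muC w) (X X' : vdc p) :
  dc_set X = dc_set X' -> X = X'.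
Proof.
case: X X' => X XP [X' XP'] /= E; case: X' / E XP' => XP'.
by rewrite (Prop_irrelevance XP XP').
Qed.

Variable ch : product_choice muB muC.
Local Notation D := (product ch).

(** The representatives of the double cosets intertwine the two images of a path
    of the product. For a vertex group this is the equation of the fiber
    product. For an edge [h], the formula for the representative of the origin
    of [h] gives that of its terminus when applied to [h^-1], and the two
    formulas differ by sliding the representative of [h] across the edge. *)
Lemma product_path_twist (x y : D) (P : gpath x y) :
  peq (pcat (gpmap muB (gpmap (rhoB ch) P)) (vpath (pv_base y) (vrep ch y)))
      (pcat (vpath (pv_base x) (vrep ch x)) (gpmap muC (gpmap (rhoC ch) P))).
Proof.
have vertex (z : D) (d : gV z) : vmapB (pv_base z) (fpval d).1 * vrep ch z =
    vrep ch z * mVg muC (pvC z) (fpval d).2.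
  by rewrite -(eqP (fpvalP d)) !mulgA mulgV mul1g.
elim: P => [z d|x' y' z d h P IH] /=.
  rewrite lmul_vpath (vertex z d) pcat_vpath_pnil; exact: peq_refl.
rewrite !gpmap_lmul !pcat_lmul -!lmulM.
apply: peq_trans (peq_pcons _ _ (peq_lmul _ IH)) _.
rewrite lmul_pcat_vpath.
have -> : gcast gV (pv_base y')
      ((two muB (peB h))^-1 * mVg muB (pvB y') (bel ch (pedge_inv h))^-1) *
      vrep ch y' =
    gomega (mE muC (peC h)) (erep ch h) *
      ((two muC (peC h))^-1 * mVg muC (pvC y') (cel ch (pedge_inv h))^-1).
  rewrite (vrepE ch (pedge_inv h)) erep_inv org_elt_mbar /ter_elt /=.
  by rewrite !gmulfM !gmulfV !mulgA mulgVK mulVg mul1g.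
apply: peq_trans (peq_edge_vpath (pv_base x') _ (pe_base h) _ _ _ _) _.
have -> : gcast gV (pv_base x')
      (mVg muB (pvB x') (rhoBV d * bel ch h) * twa muB (peB h)) *
      galpha (mE muC (peC h)) (erep ch h) =
    vrep ch x' * (mVg muC (pvC x') (rhoCV d * cel ch h) * twa muC (peC h)).
  rewrite [in RHS]gmulfM !mulgA -(vertex x' d) /rhoBV.
  move: (fpval d).1 => b; rewrite (vrepE ch h) /org_elt /=.
  by rewrite !gmulfM !mulgA mulgVK mulgVK.
rewrite -pcat_vpath_lmul /= mulg1; exact: peq_refl.
Qed.


(** An element [s] of the edge group at the common image of [f] and [g] gives an
    edge of the product over [f] and [g]; it starts at [X] as soon as its origin
    element is in [X]. *)
Section EdgeThrough.
Variables (v v1 : B) (w w1 : C) (f : hedge v v1) (g : hedge w w1).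
Variables (p : muB v = muC w) (p1 : muB v1 = muC w1).
Variable E : Edge (mE muB f) = Edge (mE muC g).
Variables (X : vdc p) (s : gE (mE muC g)).
Hypothesis Xs : dc_set X (org_elt p f s).

Definition edge_coset : edc E := DoubleCoset (ex_intro _ s erefl).

Definition ter_coset : vdc p1 :=
  DoubleCoset (ex_intro _ (ter_elt p1 f s) erefl).

Fact edge_coset_mem : dc_set edge_coset s.
Proof.
exists 1; first exact: range1.
by exists 1; [exact: range1|rewrite mul1g mulg1].
Qed.

Fact edge_through_org a : dc_set edge_coset a ->
  dc_set X = dcoset (range (vmapB p)) (org_elt p f a) (range (mVg muC w)).
Proof.
move=> ha; rewrite (vdc_eq Xs).
exact: (org_elt_dcoset p edge_coset_mem ha).
Qed.

Fact edge_through_ter a : dc_set edge_coset a ->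
  dc_set ter_coset = dcoset (range (vmapB p1)) (ter_elt p1 f a)
    (range (mVg muC w1)).
Proof. by move=> ha; exact: (ter_elt_dcoset p1 edge_coset_mem ha). Qed.

Definition edge_through : @pedge _ _ _ muB muC (PVert X) (PVert ter_coset) :=
  @PEdge _ _ _ _ _ (PVert X) (PVert ter_coset) f g E edge_coset
    edge_through_org edge_through_ter.

End EdgeThrough.

(** Conversely to [product_path_twist], paths of [B] and [C] whose images agree
    after twisting, up to sliding, come from one path of the product. The slide
    across the first edge yields the element of the edge group whose double
    coset is the first edge of the lift; the double coset of its terminus
    element is the next vertex. The element [b] makes the induction go through,
    as the first element of the tail changes at each edge. *)
Lemma product_path_lift (v v' : B) (pb : gpath v v') :
  forall (w w' : C) (pc : gpath w w') (p : muB v = muC w) (p' : muB v' = muC w')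
    (X : vdc p) (X' : vdc p') (b : gV v),
  slides (pcat (gpmap muB (lmul pb b)) (vpath p' (vrep ch (PVert X'))))
      (pcat (vpath p (vrep ch (PVert X))) (gpmap muC pc)) ->
  exists P : @gpath D (PVert X) (PVert X'),
    peq (gpmap (rhoB ch) P) (lmul pb b) /\ peq (gpmap (rhoC ch) P) pc.
Proof.
elim: pb => [x b0|x v1 y b0 f pb IH] w w' [z c0|z w1 z' c0 g pc] p p' X X' b.
- rewrite gpmap_lmul [gpmap muC _]/= pcat_vpath_pnil /= lmul_vpath.
  rewrite -gmulfM -[gcast _ _ _]/(vmapB p' (b * b0)) => /slides_vpath.
  move: p p' X X'; rewrite /= => p p'; rewrite (Prop_irrelevance p p').
  move=> X X' E; have XX' : X = X'.
    have X'x : dc_set X (vrep ch (PVert X')).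
      rewrite (vdc_eq (vrepP ch (PVert X))).
      exists (vmapB p' (b * b0)^-1); first by exists (b * b0)^-1.
      exists (mVg muC z c0); first by exists c0.
      by rewrite -mulgA -E gmulfV mulKg.
    by apply: vdc_ext; rewrite (vdc_eq X'x) (vdc_eq (vrepP ch (PVert X'))).
  case: X' / XX' E => E.
  have d_in : fiberprod_pred (vmapB p') (mVg muC z) (vrep ch (PVert X))
      (b * b0, c0).
    apply/eqP; rewrite /= -mulgA.
    by rewrite -[X in _ * X]/(vmapB p' (b * b0) * _) E mulKg.
  by exists (pnil (FiberProd d_in : @gV D (PVert X))); split; apply: peq_refl.
- rewrite gpmap_lmul [gpmap muB _]/= [gpmap muC _]/= [pcat (lmul _ _) _]/=.
  by rewrite lmul_vpath => /slides_vpath_pcons.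
- by rewrite [gpmap muC _]/= [gpmap muB _]/= => /slides_pcons_pnil.
rewrite [gpmap muB _]/= [gpmap muC _]/= [pcat (pcons _ _ _) _]/=.
move=> /slides_pcons_vpath[p1 [E [s [Es]]]].
set xt := vrep ch (PVert X) in Es *.
have {}Es : xt * mVg muC z c0 = vmapB p (b * b0) * org_elt p f s.
  apply: (mulIg (twa muC g)); rewrite -mulgA Es /org_elt /=.
  by rewrite !gmulfM !mulgA mulgVK.
have Xs : dc_set X (org_elt p f s).
  rewrite (vdc_eq (vrepP ch (PVert X))).
  exists (vmapB p (b * b0)^-1); first by exists (b * b0)^-1.
  exists (mVg muC z c0); first by exists c0.
  by rewrite -mulgA -/xt Es gmulfV mulKg.
pose h := edge_through p1 E Xs; pose y' := PVert (ter_coset f p1 s).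
have [_ [b1 _ <-] [_ [c1 _ <-] hE]] :
  dc_set (edge_coset E s) (erep ch h) := erepP ch h.
set bo := bel ch (einv (h : @hedge D (PVert X) y')).
set co := cel ch (einv (h : @hedge D (PVert X) y')).
move=> tail.
(* The representative of the coset of [s] is [mu(b1) s mu(c1)]: the factors
   [b1] and [c1] are absorbed by the vertex elements on both sides of the
   edge, and so are the twisting elements of the projections. *)
have [] := IH _ _ (lmul pc (co * (gomega g c1)^-1)) p1 p' (ter_coset f p1 s)
  X' (bo * gomega f b1).
  rewrite !gpmap_lmul !pcat_lmul pcat_vpath_lmul.
  have := slides_lmul (mVg muB v1 (bo * gomega f b1) * two muB f) tail.
  rewrite !pcat_lmul -lmulM mulgK pcat_vpath_lmul lmul_pcat_vpath.
  have -> : vrep ch y' = vmapB p1 (bo * gomega f b1) * ter_elt p1 f s *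
      mVg muC w1 (gomega g c1 * co^-1).
    rewrite (vrepE ch (pedge_inv h)) erep_inv org_elt_mbar.
    by rewrite [erep ch h]hE (ter_elt_mul p1 E) !gmulfM !gmulfV !mulgA.
  by rewrite /ter_elt /= !gmulfM !gmulfV !mulgA mulgVK mulgK.
move=> P [PB PC].
have d_in : fiberprod_pred (vmapB p) (mVg muC z) xt
    (b * b0 * (galpha f b1)^-1 * (bel ch h)^-1,
     c0 * galpha g c1 * (cel ch h)^-1).
  apply/eqP; rewrite [X in vmapB _ X]/= [X in mVg _ _ X]/=.
  apply: (mulgI xt); rewrite -mulgA mulVKg.
  rewrite [in RHS]gmulfM [in RHS]gmulfM !mulgA Es.
  rewrite {1}/xt (vrepE ch h) [erep ch h]hE (org_elt_mul p E).
  by rewrite !gmulfM !gmulfV !mulgA mulgVK mulgVK.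
pose d : @gV D (PVert X) := FiberProd d_in.
exists (@pcons D (PVert X) y' (PVert X') d h P).
split => /=; rewrite mulgVK.
  apply: peq_trans (peq_pcons _ _ (peq_lmul _ PB)) _; rewrite -lmulM mulKg.
  by have := peq_shift (b * b0 * (galpha f b1)^-1) b1 pb; rewrite mulgVK.
apply: peq_trans (peq_pcons _ _ (peq_lmul _ PC)) _; rewrite -lmulM mulKg.
by have := peq_shift (c0 * galpha g c1) c1^-1 pc; rewrite !gmulfV mulgK.
Qed.

End ProductPaths.

(** * Images of fundamental groups *)

Section Conjugation.
Variable A : graph_of_groups.

Lemma pmulKV (u v w : A) (g : phom u v) (z : phom u w) :
  pmul g (pmul (pV g) z) = z.
Proof. by rewrite pmulA pmulrV pmul1. Qed.

Lemma pmulVK (u v w : A) (g : phom u v) (z : phom v w) :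
  pmul (pV g) (pmul g z) = z.
Proof. by rewrite pmulA pmulV pmul1. Qed.

Lemma pVM (u v w : A) (g : phom u v) (h : phom v w) :
  pV (pmul g h) = pmul (pV h) (pV g).
Proof.
have [p ->] := pclass_surj g; have [q ->] := pclass_surj h.
by rewrite !(pV_class, pmul_class) pinv_cat.
Qed.

Lemma pconjP (u v : A) (H : set (pi1 u)) (g : phom u v) (z : pi1 v) :
  pconj H g z <-> exists2 h, H h & pmul h g = pmul g z.
Proof.
split; first by case=> h Hh <-; exists h => //; rewrite -!pmulA pmulKV.
by case=> h Hh E; exists h => //; rewrite -pmulA E pmulVK.
Qed.

Lemma pconjE (u v : A) (H : set (pi1 u)) (g : phom u v) (z : pi1 v) :
  pconj H g z <-> H (pmul (pmul g z) (pV g)).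
Proof.
rewrite pconjP; split.
  by case=> h Hh <-; rewrite -pmulA pmulrV pmulr1.
by move=> Hz; eexists; [exact: Hz|rewrite -pmulA pmulV pmulr1].
Qed.

Lemma pconjM (u v w : A) (H : set (pi1 u)) (g : phom u v) (h : phom v w) :
  pconj H (pmul g h) = pconj (pconj H g) h.
Proof. by apply/seteqP; split => z; rewrite !pconjE pVM !pmulA. Qed.

Lemma pconjI (u v : A) (H K : set (pi1 u)) (g : phom u v) :
  pconj (H `&` K) g = pconj H g `&` pconj K g.
Proof.
apply/seteqP; split => z.
  by move=> /pconjE[Hz Kz]; split; apply/pconjE.
by case=> /pconjE Hz /pconjE Kz; apply/pconjE.
Qed.

Lemma pconjS (u v : A) (H K : set (pi1 u)) (g : phom u v) :
  H `<=` K -> pconj H g `<=` pconj K g.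
Proof. by move=> HK z; rewrite !pconjE; apply: HK. Qed.

(** Transport along an equality of vertices is conjugation by the trivial path
    between them. *)
Lemma pi1_castE (u v : A) (r : u = v) (H : set (pi1 u)) :
  pi1_cast r H = pconj H (pclass (vpath r 1)).
Proof.
case: v / r; apply/seteqP; split => z /=; rewrite pconjE pV_class /= invg1.
  by rewrite pmul1 pmulr1.
by rewrite pmul1 pmulr1.
Qed.

End Conjugation.

Section ImageConjugation.
Variables (B A : graph_of_groups) (mu : morphism B A).

Lemma mstarV (u v : B) (g : phom u v) : mstar mu (pV g) = pV (mstar mu g).
Proof.
rewrite -[LHS]pmulr1 -(pmulrV (mstar mu g)) pmulA -mstarM pmulV.
by rewrite /pone mstar_class /= gmulf1 pmul1.
Qed.

(** Conjugation by a path moves the base point of the fundamental group. *)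
Lemma pi1_image_conj (u v : B) (g : phom u v) :
  pconj (pi1_image mu u) (mstar mu g) = pi1_image mu v.
Proof.
apply/seteqP; split=> z.
  case=> _ [x _ <-] <-; exists (pmul (pmul (pV g) x) g) => //.
  by rewrite !mstarM mstarV.
case=> x _ <-; apply/pconjE; rewrite -mstarV -!mstarM.
by eexists.
Qed.

Variables (C : graph_of_groups) (nu : morphism C B).

Lemma gpmap_comp (u v : C) (p : gpath u v) :
  gpmap (comp_morphism mu nu) p = gpmap mu (gpmap nu p).
Proof.
elim: p => [x a|x v' w a e p /= ->] //=.
by rewrite gpmap_lmul -lmulM !gmulfM gmulfV invgM !mulgA.
Qed.

Lemma mstar_comp (u v : C) (x : phom u v) :
  mstar (comp_morphism mu nu) x = mstar mu (mstar nu x).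
Proof. by have [p ->] := pclass_surj x; rewrite !mstar_class gpmap_comp. Qed.

Lemma pi1_image_comp (v : C) :
  pi1_image (comp_morphism mu nu) v = mstar mu @` pi1_image nu v.
Proof.
apply/seteqP; split=> z [x].
  by move=> _ <-; exists (mstar nu x); [exists x|rewrite mstar_comp].
by case=> y _ <- <-; exists y => //; rewrite mstar_comp.
Qed.

Lemma pi1_image_comp_sub (v : C) :
  pi1_image (comp_morphism mu nu) v `<=` pi1_image mu (nu v).
Proof. by rewrite pi1_image_comp => z [x _ <-]; exists x. Qed.

End ImageConjugation.

Section ProductImages.
Variables (A B C : graph_of_groups).
Variables (muB : morphism B A) (muC : morphism C A).
Variable ch : product_choice muB muC.
Variables (v : B) (w : C) (p : muB v = muC w) (X : vdc p).

Let x : product ch := PVert X.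
Let xt : phom (muB v) (muC w) := pclass (vpath p (vrep ch x)).
Let imBD := pi1_image (comp_morphism muB (rhoB ch)) x.
Let imCD := pi1_image (comp_morphism muC (rhoC ch)) x.
Let I := pconj (pi1_image muB v) xt `&` pi1_image muC w.

Lemma product_image_twist (z : pi1 x) :
  pmul (mstar muB (mstar (rhoB ch) z)) xt =
  pmul xt (mstar muC (mstar (rhoC ch) z)).
Proof.
have [P ->] := pclass_surj z; rewrite !mstar_class !pmul_class.
apply/pclassP; exact: (product_path_twist P).
Qed.

Lemma product_image_conj : pconj imBD xt = imCD.
Proof.
apply/seteqP; split=> z.
  case/pconjP=> _ [y _ <-]; rewrite mstar_comp product_image_twist => E.
  exists y => //; rewrite mstar_comp.
  by rewrite -[LHS](pmulVK xt) E pmulVK.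
case=> y _ <-; apply/pconjP; exists (mstar (comp_morphism muB (rhoB ch)) y).
  by exists y.
by rewrite !mstar_comp product_image_twist.
Qed.

Lemma product_image_sub : imCD `<=` I.
Proof.
move=> z Iz; split; last exact: pi1_image_comp_sub Iz.
move: Iz; rewrite -product_image_conj; apply: pconjS.
exact: pi1_image_comp_sub.
Qed.

(** An element of the intersection is the image of reduced circuits of [B] and
    of [C]. Immersions keep them reduced, so their images, which agree after
    twisting by the representative of [x], are related by slides, and the
    circuits lift to the product. *)
Lemma product_image_immersion : immersion muB -> immersion muC -> imCD = I.
Proof.
move=> immB immC; apply/seteqP; split; first exact: product_image_sub.
move=> z [/pconjP[_ [b _ <-] E] [c _ cz]]; move: E; rewrite -cz.
have [pb pb_red ->] := reduced_repr b; have [pc pc_red ->] := reduced_repr c.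
rewrite !mstar_class !pmul_class => /pclassP E.
have [|P [_ PC]] := @product_path_lift _ _ _ _ _ ch _ _ pb _ _ pc p p X X 1.
  rewrite lmul1; apply: peq_reduced_slides E.
    exact/reduced_pcat_vpath/reduced_gpmap.
  exact/reduced_vpath_pcat/reduced_gpmap.
have PcE : mstar (rhoC ch) (pclass P) = pclass pc.
  by rewrite mstar_class; apply/pclassP.
by exists (pclass P) => //; rewrite mstar_comp PcE mstar_class.
Qed.

End ProductImages.

Theorem corollary3p17 (A B C : graph_of_groups)
    (muB : morphism B A) (muC : morphism C A) (ch : product_choice muB muC) :
  [/\
    forall (v : B) (w : C) (p : muB v = muC w) (X : vdc p),
      let x : product ch := PVert X in
      let xt : phom (muB v) (muC w) := pclass (vpath p (vrep ch x)) in
      let imBD := pi1_image (comp_morphism muB (rhoB ch)) x in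
      let imCD := pi1_image (comp_morphism muC (rhoC ch)) x in
      let I := pconj (pi1_image muB v) xt `&` pi1_image muC w in
      [/\ pconj imBD xt = imCD,
          imCD `<=` I
        & immersion muB -> immersion muC -> imCD = I],
    forall (u0 : A) (v0 : B) (w0 : C) (hv : muB v0 = u0) (hw : muC w0 = u0),
      let x0 : product ch := pbase (etrans hv (esym hw)) in
      vrep ch x0 = 1 ->
      let imBD := pi1_cast hv (pi1_image (comp_morphism muB (rhoB ch)) x0) in
      let imCD := pi1_cast hw (pi1_image (comp_morphism muC (rhoC ch)) x0) in
      let I := pi1_cast hv (pi1_image muB v0)
               `&` pi1_cast hw (pi1_image muC w0) in
      [/\ imBD = imCD,
          imCD `<=` I
        & immersion muB -> immersion muC -> imCD = I]
  & forall (u0 : A) (v0 : B) (w0 : C) (hv : muB v0 = u0) (hw : muC w0 = u0)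
        (v : B) (w : C) (p : muB v = muC w) (X : vdc p)
        (pv : gpath v0 v) (qw : gpath w0 w),
      reduced pv -> reduced qw ->
      let x : product ch := PVert X in
      let xt : phom (muB v) (muC w) := pclass (vpath p (vrep ch x)) in
      let mupv : phom (muB v0) (muB v) := pclass (gpmap muB pv) in
      let muqw : phom (muC w0) (muC w) := pclass (gpmap muC qw) in
      let L := pconj (mstar muC @` pi1_image (rhoC ch) x) (pV muqw) in
      let I := pconj (pi1_image muB v0) (pmul (pmul mupv xt) (pV muqw))
               `&` pi1_image muC w0 in
      L `<=` I /\ (immersion muB -> immersion muC -> L = I)].
Proof.
split.
- move=> v w p X x xt imBD imCD I; split.
  + exact: product_image_conj.
  + exact: product_image_sub.
  + exact: product_image_immersion.
- move=> u0 v0 w0 hv hw; case: u0 / hw hv => hv x0 x01 imBD imCD I.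
  pose xt : phom (muB v0) (muC w0) := pclass (vpath hv (vrep ch x0)).
  have castE H : pi1_cast hv H = pconj H xt by rewrite pi1_castE /xt x01.
  have imBDE : imBD = pconj (pi1_image (comp_morphism muB (rhoB ch)) x0) xt.
    exact: castE.
  have IE : I = pconj (pi1_image muB v0) xt `&` pi1_image muC w0.
    by rewrite /I castE.
  rewrite imBDE IE; split.
  + exact: product_image_conj.
  + exact: product_image_sub.
  + exact: product_image_immersion.
- move=> u0 v0 w0 _ _ v w p X pv qw _ _ x xt mupv muqw L I.
  pose imCD := pi1_image (comp_morphism muC (rhoC ch)) x.
  have LE : L = pconj imCD (pV muqw) by rewrite /L -pi1_image_comp.
  have mupvE : mupv = mstar muB (pclass pv) by rewrite mstar_class.
  have muqwE : pV muqw = mstar muC (pV (pclass qw)).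
    by rewrite mstarV mstar_class.
  have IE : I = pconj (pconj (pi1_image muB v) xt `&` pi1_image muC w)
      (pV muqw).
    have CE : pconj (pi1_image muC w) (pV muqw) = pi1_image muC w0.
      by rewrite muqwE pi1_image_conj.
    by rewrite /I !pconjM mupvE pi1_image_conj pconjI CE.
  rewrite LE IE; split; first exact/pconjS/product_image_sub.
  by move=> immB immC; rewrite -product_image_immersion.
Qed.
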